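(* Let $n$ be a positive integer relatively prime to $6$ such that $n\not\equiv\pm1\pmod 9$ and no exponent in the prime factorization of $n$ is a multiple of $3$, and let $n'$ be the largest squarefree divisor of $n$. Then for every $s\in\mathbb{C}$ with $\mathrm{Re}\,s>1$, $$F(\omega,s)=\frac{2\pi n'\sigma(n/n')}{3(1-3^{-2s})}\Big(\frac{\sqrt3}{2}\Big)^s\frac{L_k(s,\chi)}{\zeta(2s)}\prod_{p\mid n}\frac{1-p^{-2}}{1-p^{-2s}}.$$
   Context: $\omega:=e^{2\pi i/3}$, $k:=\mathbb{Q}(\omega)$, $\sigma$ the sum-of-divisors function, $\zeta$ the Riemann zeta function. $n=\prod_i\lambda_i^{c_i}$ is the prime factorization in $\mathbb{Z}[\omega]$, $(\cdot/\lambda)_3$ the cubic residue symbol; $\chi(z):=\prod_i(z/\lambda_i)_3^{c_i}$ for $z\in\mathbb{Z}[\omega]$ coprime to $3n$ and $\chi(z):=0$ otherwise; $L_k(s,\chi):=\sum_{z\in\mathbb{Z}[\omega],\ z\equiv1\ (\mathrm{mod}\ 3)}\chi(z)|z|^{-2s}$. $f(d):=d\prod_{p\mid d}[1-p^{-1}(\frac p3)]$. For coprime $\alpha,\beta$: $\delta:=\gcd(n,\alpha^2+\alpha\beta+\beta^2)$, $C(\alpha,\beta):=\sum_{d\mid n,\ \gcd(d,\delta)=1}d^2\frac{f(n)}{3f(d)}\prod_{p\mid d}(1-p^{-2})+\frac23\mathrm{Re}\big[\prod_i(\frac{\alpha-\beta\omega}{\lambda_i})_3^{c_i}\big]\sum_{n'\mid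 d\mid n}dn\prod_{p\mid d}(1-p^{-2})$. For $\tau\in\mathbb{H}$, $\mathrm{Re}\,s>1$: $F(\tau,s):=\frac{2\pi}{3n}\sum_{\gamma=\begin{bsmallmatrix}a&b\\c&d\end{bsmallmatrix}\in\langle T^3\rangle\backslash\Gamma(3)}[C(d,-c)(\mathrm{Im}\gamma\tau)^s-C(c,d)(\mathrm{Im}\gamma S\tau)^s]$, $S=\begin{bsmallmatrix}0&-1\\1&0\end{bsmallmatrix}$, $T=\begin{bsmallmatrix}1&1\\0&1\end{bsmallmatrix}$. *)

(* Defs.v *)
From HB Require Import structures.
From mathcomp Require Import all_boot all_order all_algebra finmap.
From mathcomp Require Import generic_quotient ring.
From mathcomp Require Import all_classical all_reals all_analysis.
From mathcomp.analysis.showcase Require summability.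
From mathcomp Require Import complex.

Set Implicit Arguments.
Unset Strict Implicit.
Unset Printing Implicit Defensive.

Import Order.TTheory GRing.Theory Num.Theory.
Import numFieldNormedType.Exports.

Local Open Scope ring_scope.
Local Open Scope complex_scope.

Local Notation Re := (@complex.Re _).
Local Notation Im := (@complex.Im _).

(* [Eisenstein a b] is the element [a + b * omega] of Z[omega], where
   [omega ^ 2 = - 1 - omega]. *)
Record eisenstein := Eisenstein { eis_re : int; eis_om : int }.

Definition eis_pair (z : eisenstein) : int * int := (eis_re z, eis_om z).
Definition pair_eis (u : int * int) : eisenstein := Eisenstein u.1 u.2.

Lemma eis_pairK : cancel eis_pair pair_eis.
Proof. by case. Qed.

HB.instance Definition _ := Countable.copy eisenstein (can_type eis_pairK).

Definition eis_add (x y : eisenstein) : eisenstein :=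
  Eisenstein (eis_re x + eis_re y) (eis_om x + eis_om y).
Definition eis_opp (x : eisenstein) : eisenstein :=
  Eisenstein (- eis_re x) (- eis_om x).
Definition eis_mul (x y : eisenstein) : eisenstein :=
  Eisenstein (eis_re x * eis_re y - eis_om x * eis_om y)
    (eis_re x * eis_om y + eis_om x * eis_re y - eis_om x * eis_om y).

Lemma eis_addA : associative eis_add.
Proof. by move=> [a b] [c d] [e f]; rewrite /eis_add /= !addrA. Qed.
Lemma eis_addC : commutative eis_add.
Proof. by move=> [a b] [c d]; congr Eisenstein; rewrite /= addrC. Qed.
Lemma eis_add0 : left_id (Eisenstein 0 0) eis_add.
Proof. by move=> [a b]; rewrite /eis_add /= !add0r. Qed.
Lemma eis_addN : left_inverse (Eisenstein 0 0) eis_opp eis_add.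
Proof. by move=> [a b]; rewrite /eis_add /= !addNr. Qed.

HB.instance Definition _ :=
  GRing.isZmodule.Build eisenstein eis_addA eis_addC eis_add0 eis_addN.

Lemma eis_mulA : associative eis_mul.
Proof. by move=> [a b] [c d] [e f]; congr Eisenstein => /=; ring. Qed.
Lemma eis_mulC : commutative eis_mul.
Proof. by move=> [a b] [c d]; congr Eisenstein => /=; ring. Qed.
Lemma eis_mul1 : left_id (Eisenstein 1 0) eis_mul.
Proof. by move=> [a b]; congr Eisenstein => /=; ring. Qed.
Lemma eis_mulDl : left_distributive eis_mul eis_add.
Proof. by move=> [a b] [c d] [e f]; congr Eisenstein => /=; ring. Qed.
Lemma eis_1neq0 : Eisenstein 1 0 != 0.
Proof. by []. Qed.

HB.instance Definition _ := GRing.Zmodule_isComNzRing.Build eisenstein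
  eis_mulA eis_mulC eis_mul1 eis_mulDl eis_1neq0.

Definition eis_omega : eisenstein := Eisenstein 0 1.

(* |a + b omega|^2 = a^2 - a b + b^2 *)
Definition eis_norm (z : eisenstein) : int :=
  eis_re z ^+ 2 - eis_re z * eis_om z + eis_om z ^+ 2.

Definition rdvd (A : comNzRingType) (x y : A) : Prop := exists z, y = z * x.
Definition runit (A : comNzRingType) (x : A) : Prop := rdvd x 1.
Definition rassoc (A : comNzRingType) (x y : A) : Prop :=
  exists2 u, runit u & y = u * x.
Definition rcoprime (A : comNzRingType) (x y : A) : Prop :=
  forall z, rdvd z x -> rdvd z y -> runit z.
Definition rprime (A : comNzRingType) (p : A) : Prop :=
  [/\ p <> 0, ~ runit p &
      forall x y, rdvd p (x * y) -> rdvd p x \/ rdvd p y].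

Definition prime_factorization (A : comNzRingType) (a : A)
    (r : nat) (lam : 'I_r -> A) (c : 'I_r -> nat) : Prop :=
  [/\ forall i, rprime (lam i),
      forall i, (0 < c i)%N,
      forall i j, rassoc (lam i) (lam j) -> i = j
    & a = \prod_i lam i ^+ c i].

(* (z / lam)_3, for lam a prime not dividing 3: it is 0 if lam divides z, and
   otherwise the cube root of unity congruent to z^((N(lam) - 1) / 3) modulo
   lam. *)
Definition cubic_residue (lam z : eisenstein) : eisenstein :=
  if `[< rdvd lam z >] then 0 else
  if [pick k : 'I_3 | `[< rdvd lam
       (z ^+ ((`|eis_norm lam|%N - 1) %/ 3) - eis_omega ^+ k) >]] is Some k
  then eis_omega ^+ k else 0.

Definition cubic_residue_prod (r : nat) (lam : 'I_r -> eisenstein)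
    (c : 'I_r -> nat) (z : eisenstein) : eisenstein :=
  \prod_i cubic_residue (lam i) z ^+ c i.

Definition cubic_char (n r : nat) (lam : 'I_r -> eisenstein)
    (c : 'I_r -> nat) (z : eisenstein) : eisenstein :=
  if `[< rcoprime z (3 * n)%:R >] then cubic_residue_prod lam c z else 0.

Definition squarefree (d : nat) : bool :=
  (0 < d)%N && all (fun p => ~~ (p ^ 2 %| d)%N) (primes d).

Definition max_squarefree_divisor (n : nat) : nat :=
  (\max_(d <- divisors n | squarefree d) d)%N.

Definition sum_divisors (m : nat) : nat := (\sum_(d <- divisors m) d)%N.

(* (a / q) for q an odd prime *)
Definition legendre (a q : nat) : int :=
  if a%:R == 0 :> 'F_q then 0
  else if [exists x : 'F_q, x ^+ 2 == a%:R] then 1 else -1.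

Section Complex.
Variable R : realType.
Implicit Types (s z tau : R[i]) (x : R).

Definition cexp z : R[i] := (expR (Re z))%:C * (cos (Im z) +i* sin (Im z)).

(* x ^ s for x > 0, with the real logarithm *)
Definition cpow x s : R[i] := cexp (s * (ln x)%:C).

Definition omega : R[i] := cexp ((2 * pi / 3)%:C * 'i).

Definition eis_val (z : eisenstein) : R[i] :=
  (eis_re z)%:~R + (eis_om z)%:~R * omega.

(* unordered sum: limit of the sums over finite subsets, ordered by inclusion *)
Definition csum (I : choiceType) (u : I -> R[i]) : R[i] :=
  summability.sum (u : I -> R[i]^o).

(* Riemann zeta function on the half-plane Re s > 1 *)
Definition zeta s : R[i] :=
  limn (series (fun m : nat => cpow m.+1%:R (- s) : R[i]^o)).

Definition L_k (chi : eisenstein -> eisenstein) s : R[i] :=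
  csum (fun z : {z : eisenstein | `[< rdvd 3%:R (z - 1) >]} =>
    eis_val (chi (val z)) * cpow (Re `|eis_val (val z)|) (- (2 * s))).

Definition f_coef (d : nat) : R :=
  d%:R * \prod_(p <- primes d) (1 - p%:R^-1 * (legendre p 3)%:~R).

Definition C_coef (n r : nat) (lam : 'I_r -> eisenstein) (c : 'I_r -> nat)
    (alpha beta : int) : R :=
  let delta := `|gcdz n (alpha ^+ 2 + alpha * beta + beta ^+ 2)|%N in
  \sum_(d <- divisors n | coprime d delta)
     d%:R ^+ 2 * (f_coef n / (3 * f_coef d)) * \prod_(p <- primes d) (1 - p%:R ^- 2)
  + 2 / 3
    * Re (eis_val (cubic_residue_prod lam c
                     (alpha%:~R - beta%:~R * eis_omega)))
    * \sum_(d <- divisors n | (max_squarefree_divisor n %| d)%N)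
         d%:R * n%:R * \prod_(p <- primes d) (1 - p%:R ^- 2).

Definition mobius (g : 'M[int]_2) tau : R[i] :=
  ((g 0 0)%:~R * tau + (g 0 1)%:~R) / ((g 1 0)%:~R * tau + (g 1 1)%:~R).

End Complex.

Definition Smx : 'M[int]_2 :=
  \matrix_(i, j) (if (i == 0) && (j == 1) then -1
                  else if (i == 1) && (j == 0) then 1 else 0).
Definition Tmx : 'M[int]_2 :=
  \matrix_(i, j) (if (i == 1) && (j == 0) then 0 else 1).

Definition in_Gamma3 (g : 'M[int]_2) : bool :=
  (\det g == 1) &&
  [forall i, forall j, (g i j == (1%:M : 'M[int]_2) i j %[mod 3])%Z].

Definition Gamma3 : Type := {g : 'M[int]_2 | in_Gamma3 g}.
HB.instance Definition _ := Choice.on Gamma3.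

Definition same_coset (g h : Gamma3) : bool :=
  `[< exists k : int, val h = (Tmx ^+ 3) ^ k * val g >].

Lemma Tmx3_unit : Tmx ^+ 3 \is a GRing.unit.
Proof.
rewrite unitrX // -[_ \is a _]/(_ \in unitmx) unitmxE.
suff -> : \det Tmx = 1 by [].
by rewrite (expand_det_row _ 0) !big_ord_recl big_ord0 /cofactor !det_mx11 !mxE.
Qed.

Lemma same_coset_refl : reflexive same_coset.
Proof. by move=> g; apply/asboolP; exists 0; rewrite expr0z mul1r. Qed.

Lemma same_coset_sym : symmetric same_coset.
Proof.
suff H g h : same_coset g h -> same_coset h g by move=> g h; apply/idP/idP; exact: H.
move=> /asboolP[k hk]; apply/asboolP; exists (- k).
by rewrite hk mulrA -exprzDr ?Tmx3_unit // addNr expr0z mul1r.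
Qed.

Lemma same_coset_trans : transitive same_coset.
Proof.
move=> h g l /asboolP[k hk] /asboolP[m hm]; apply/asboolP; exists (m + k).
by rewrite hm hk mulrA exprzDr // Tmx3_unit.
Qed.

Canonical same_coset_equiv :=
  EquivRel same_coset same_coset_refl same_coset_sym same_coset_trans.

(* the coset space <T^3> \ Gamma(3) *)
Definition Gamma3_cosets : Type := {eq_quot same_coset_equiv}%qT.
HB.instance Definition _ := Choice.on Gamma3_cosets.

(* The summand only depends on the coset of g: multiplying g by T^3 on the left
   keeps its bottom row and translates [mobius g tau] by 3. *)
Definition F_series (R : realType) (n r : nat) (lam : 'I_r -> eisenstein)
    (c : 'I_r -> nat) (tau s : R[i]) : R[i] :=
  (2 * pi / (3 * n%:R))%:C *
  csum (fun q : Gamma3_cosets =>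
    let g := val (repr q : Gamma3) in
      (C_coef R n lam c (g 1 1) (- g 1 0))%:C * cpow (Im (mobius g tau)) s
    - (C_coef R n lam c (g 1 0) (g 1 1))%:C * cpow (Im (mobius (g * Smx) tau)) s).

(* Main.v *)
Require Import Defs.
From mathcomp Require Import all_boot all_order all_algebra finmap.
From mathcomp Require Import generic_quotient ring lra zify.
From mathcomp Require Import all_classical all_reals all_analysis.
From mathcomp.analysis.showcase Require summability.
From mathcomp Require Import complex.

(* Write z = d + c omega for the bottom row (c, d) of a matrix in Gamma(3).
   The cosets of <T^3> correspond to the primitive z = 1 (mod 3), and
   Im(gamma omega) = (sqrt 3 / 2) / N(z).  The two terms of the summand of F
   belong to z and to - omega w with w = (c + d) + c omega; since z |-> w
   permutes the primitive elements = 1 (mod 3), the part of C that only depends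
   on the norm cancels.  As n^2 <> 1 (mod 9), chi(omega) is a primitive cube
   root of unity, of real part -1/2; as n is rational, chi commutes with
   conjugation and the imaginary parts cancel.  Hence F(omega, s) is a multiple
   of P, the sum of chi(w) N(w)^(-s) over the primitive w = 1 (mod 3).
   Finally, every z = 1 (mod 3) is uniquely +-m w with m > 0 prime to 3 and such
   a w, and chi(m) is a real cube root of unity or 0, so L_k(s, chi) is P times
   the sum of m^(-2s) over the m prime to 3n, an Euler-sieved zeta(2s). *)

Set Implicit Arguments.
Unset Strict Implicit.
Unset Printing Implicit Defensive.

Import Order.TTheory GRing.Theory Num.Theory.
Import numFieldNormedType.Exports.

Local Open Scope ring_scope.
Local Open Scope complex_scope.

(** * Unordered sums *)

Section UnorderedSums.
Variable K : numFieldType.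

(** The statement mixes limits of different shapes: [csum] over cosets, [csum] over a subtype of
    Z[omega], and the ordered series of [zeta]. All are reduced to [has_sum], under which families
    can be added, reindexed and multiplied; absolute convergence supplies the existence of each sum.
    The character is built from an arbitrary choice of primes [lam], so its compatibility with
    conjugation is not visible: conjugation permutes these primes only up to units. Unique
    factorization, in the form of [prod_prime_assoc], absorbs the units. Since s is complex, the
    powers of norms are not real. Real parts are therefore only taken of chi, and the pairing of z
    with its conjugate works because the two have the same norm. The final formula divides by
    zeta(2s), which must be known not to vanish; as Re(2s) > 2, comparing the tail of the series
    with its first term is enough. *)

Definition has_sum (I : choiceType) (f : I -> K) (S : K) : Prop :=
  forall e : K, 0 < e -> exists A : seq I, forall B : seq I,
    uniq B -> {subset A <= B} -> `|\sum_(i <- B) f i - S| < e.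

Definition abs_summable (I : choiceType) (f : I -> K) : Prop :=
  exists M : K, forall A : seq I, uniq A -> \sum_(i <- A) `|f i| <= M.

Lemma has_sum_ext (I : choiceType) (f g : I -> K) S :
  f =1 g -> has_sum f S -> has_sum g S.
Proof. by move=> /funext ->. Qed.

Lemma has_sumD (I : choiceType) (f g : I -> K) S T :
  has_sum f S -> has_sum g T -> has_sum (fun i => f i + g i) (S + T).
Proof.
move=> hS hT e e0; have e20 : 0 < e / 2 by rewrite divr_gt0 ?ltr0n.
have [A hA] := hS _ e20; have [B hB] := hT _ e20.
exists (A ++ B) => X uX sX; rewrite big_split /= opprD addrACA (splitr e).
apply: le_lt_trans (ler_normD _ _) (ltrD (hA _ uX _) (hB _ uX _)) => y yA;
  by apply: sX; rewrite mem_cat yA ?orbT.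
Qed.

Lemma has_sumZ (I : choiceType) (f : I -> K) S a :
  has_sum f S -> has_sum (fun i => a * f i) (a * S).
Proof.
move=> hS e e0; have [->|a0] := eqVneq a 0.
  exists [::] => B _ _; rewrite big1 ?mul0r ?subrr ?normr0 // => i _.
  by rewrite mul0r.
have [A hA] := hS (e / `|a|) ltac:(by rewrite divr_gt0 ?normr_gt0).
exists A => B uB sB; rewrite -mulr_sumr -mulrBr normrM mulrC.
by rewrite -ltr_pdivlMr ?normr_gt0 // hA.
Qed.

Lemma has_sumB (I : choiceType) (f g : I -> K) S T :
  has_sum f S -> has_sum g T -> has_sum (fun i => f i - g i) (S - T).
Proof.
move=> hS hT; have := has_sumD hS (has_sumZ (-1) hT); rewrite mulN1r.
by apply: has_sum_ext => i; rewrite mulN1r.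
Qed.

(** The inverse is option-valued so that [pmap] turns a list over [I] into the list of its
    preimages, with no default element of [J], which may be empty. *)
Lemma partial_inverse (I J : choiceType) (h : J -> I) : injective h ->
  exists g : I -> option J, pcancel h g /\ ocancel g h.
Proof.
move=> inj; exists (fun i => if pselect (exists j, h j == i) is left p
  then Some (xchoose p) else None); split => [j|i].
  case: pselect => [p|[]]; last by exists j.
  by congr Some; apply: inj; apply/eqP/(xchooseP p).
by case: pselect => //= p; apply/eqP/(xchooseP p).
Qed.

Lemma has_sum_reindex (I J : choiceType) (h : J -> I) (f : I -> K) S :
  injective h -> (forall i, f i != 0 -> exists j, h j = i) ->
  has_sum (f \o h) S <-> has_sum f S.
Proof.
move=> inj sur; have [g [hK gK]] := partial_inverse inj.
have sumE B : \sum_(i <- B) f i = \sum_(j <- pmap g B) f (h j).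
  rewrite big_pmap; apply: eq_bigr => i _.
  case gi: (g i) => [j|] /=; first by have := gK i; rewrite gi /= => ->.
  by apply/eqP/negPn/negP => /sur[j hj]; move: gi; rewrite -hj hK.
split=> hS e e0; have [A hA] := hS e e0.
  exists (map h A) => B uB sB; rewrite sumE; apply: hA.
    exact: (pmap_uniq gK).
  move=> j jA; have /sB hjB : h j \in map h A by exact: map_f.
  by rewrite mem_pmap; apply/mapP; exists (h j).
exists (pmap g A) => B uB sB.
(* [A] may contain indices outside the image of [h]; they are added because [B'] must contain [A],
   and they contribute 0. *)
pose B' := map h B ++ [seq i <- undup A | i \notin map h B].
have -> : \sum_(j <- B) (f \o h) j = \sum_(i <- B') f i.
  rewrite big_cat big_map /= [X in _ + X]big1_seq ?addr0 // => i /andP[_].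
  rewrite mem_filter mem_undup => /andP[/negP iB iA]; apply/eqP/negPn/negP.
  move=> /sur[j hj]; apply: iB; rewrite -hj; apply/map_f/sB.
  by rewrite mem_pmap -(hK j) hj; exact: map_f.
apply: hA.
  rewrite cat_uniq map_inj_uniq // uB filter_uniq ?undup_uniq // andbT.
  by apply/hasPn => i; rewrite mem_filter => /andP[].
move=> i iA; rewrite mem_cat mem_filter mem_undup iA andbT.
exact: orbN.
Qed.

(** As [U] is given, only uniqueness of the limit is at stake: on one finite rectangle covering the
    three witness lists, the sum is a product [a * b], close both to [U] and to [S * T]. *)
Lemma has_sum_prod (I J : choiceType) (f : I -> K) (g : J -> K) S T U :
  has_sum f S -> has_sum g T -> has_sum (fun p => f p.1 * g p.2) U ->
  U = S * T.
Proof.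
move=> hS hT hU; apply/eqP; rewrite -subr_eq0 -normr_eq0 distrC.
apply/negPn/negP => nz; set d := `|S * T - U| in nz; have d0 : 0 < d by rewrite lt_def nz normr_ge0.
set k := `|S| + `|T| + 2.
have k0 : 0 < k by rewrite /k ltr_wpDl ?ltr0n ?addr_ge0.
(* The errors below add up to less than [e * k]. This choice gives [e * k < d], and also [e < 1],
   which bounds the norm of [b] by that of [T] plus 1. *)
set e := d / (d + k).
have dk0 := addr_gt0 d0 k0.
have e0 : 0 < e by exact: divr_gt0 d0 dk0.
have e1 : e < 1 by rewrite /e ltr_pdivrMr // mul1r ltrDl.
have ek : e * k < d.
  by rewrite /e mulrAC ltr_pdivrMr // ltr_pM2l // ltrDr.
have [A hA] := hS _ e0; have [B hB] := hT _ e0; have [P hP] := hU _ e0.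
pose X := undup (A ++ map fst P); pose Y := undup (B ++ map snd P).
have uX : uniq X by exact: undup_uniq.
have uY : uniq Y by exact: undup_uniq.
have {}hA : `|\sum_(i <- X) f i - S| < e.
  by apply: hA => // x xA; rewrite mem_undup mem_cat xA.
have {}hB : `|\sum_(i <- Y) g i - T| < e.
  by apply: hB => // x xA; rewrite mem_undup mem_cat xA.
have {}hP : `|\sum_(p <- [seq (x, y) | x <- X, y <- Y]) f p.1 * g p.2 - U| < e.
  apply: hP; first by apply: allpairs_uniq => // -[? ?] [? ?] _ _ [-> ->].
  move=> [x y] xyP; apply/allpairsP; exists (x, y); split => //=;
    rewrite mem_undup mem_cat.
    by rewrite (map_f fst xyP) orbT.
  by rewrite (map_f snd xyP) orbT.
move: hP; rewrite big_allpairs /=.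
under eq_bigr do rewrite -mulr_sumr.
rewrite -mulr_suml; move: hA hB.
set a := \sum_(i <- X) _; set b := \sum_(i <- Y) _ => hA hB hU'.
have : d < d; last by rewrite ltxx.
apply: lt_trans ek; rewrite /d.
have -> : S * T - U = (S - a) * b + S * (T - b) + (a * b - U) by ring.
apply: le_lt_trans (ler_normD _ _) _.
have -> : e * k = (e * (`|T| + 1) + `|S| * e) + e by rewrite /k; ring.
apply: ler_ltD => //; apply: le_trans (ler_normD _ _) _.
rewrite !normrM; apply: lerD; apply: ler_pM => //; try by rewrite distrC ltW.
rewrite -(subrK T b) addrC; apply: le_trans (ler_normD _ _) _.
by rewrite lerD2l ltW // (lt_trans hB).
Qed.

Lemma ler_sum_subset (I : eqType) (f : I -> K) (A B : seq I) :
  (forall i, 0 <= f i) -> uniq A -> uniq B -> {subset A <= B} ->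
  \sum_(i <- A) f i <= \sum_(i <- B) f i.
Proof.
move=> f0 uA uB AB; rewrite [leRHS](bigID (mem A)) /= -[leLHS]addr0.
apply: lerD; last exact: sumr_ge0.
rewrite -[leRHS]big_filter le_eqVlt; apply/orP; left; apply/eqP.
apply: perm_big; apply: uniq_perm => //; first exact: filter_uniq.
by move=> x; rewrite mem_filter; apply/esym/andb_idr/AB.
Qed.

Lemma abs_summable_le (I : choiceType) (f g : I -> K) :
  (forall i, `|f i| <= `|g i|) -> abs_summable g -> abs_summable f.
Proof.
move=> fg [M hM]; exists M => A uA; apply: le_trans (hM A uA).
exact: ler_sum.
Qed.

Lemma abs_summableZ (I : choiceType) (f : I -> K) a :
  abs_summable f -> abs_summable (fun i => a * f i).
Proof.
move=> [M hM]; exists (`|a| * M) => A uA.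
under eq_bigr do rewrite normrM.
by rewrite -mulr_sumr ler_wpM2l // hM.
Qed.

Lemma abs_summable_comp (I J : choiceType) (h : J -> I) (f : I -> K) :
  injective h -> abs_summable f -> abs_summable (f \o h).
Proof.
move=> inj [M hM]; exists M => A uA.
by rewrite -(big_map h xpredT (fun i => `|f i|)) hM // map_inj_uniq.
Qed.

Lemma abs_summable_prod (I J : choiceType) (f : I -> K) (g : J -> K) :
  abs_summable f -> abs_summable g ->
  abs_summable (fun p => f p.1 * g p.2).
Proof.
move=> [M hM] [N hN]; exists (M * N) => P uP.
pose X := undup (map fst P); pose Y := undup (map snd P).
have uX : uniq X by exact: undup_uniq.
have uY : uniq Y by exact: undup_uniq.
have uXY : uniq [seq (x, y) | x <- X, y <- Y].
  by apply: allpairs_uniq => // -[? ?] [? ?] _ _ [-> ->].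
apply: le_trans (_ : \sum_(p <- [seq (x, y) | x <- X, y <- Y])
    `|f p.1 * g p.2| <= _); last first.
  rewrite big_allpairs /=.
  under eq_bigr do under eq_bigr do rewrite normrM.
  under eq_bigr do rewrite -mulr_sumr.
  rewrite -mulr_suml; apply: ler_pM; rewrite ?sumr_ge0 ?hM ?hN //.
apply: ler_sum_subset => // -[x y] xyP.
apply/allpairsP; exists (x, y); split => //=; rewrite mem_undup.
  exact: (map_f fst xyP).
exact: (map_f snd xyP).
Qed.

End UnorderedSums.

Section ComplexSums.
Variable R : realType.

Lemma complex_gt0 (e : R[i]) : 0 < e -> exists2 d : R, 0 < d & e = d%:C.
Proof.
by case: e => a b; rewrite ltcE /= => /andP[/eqP -> a0]; exists a.
Qed.

Lemma sum_complex (I : Type) (s : seq I) (f : I -> R) :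
  (\sum_(i <- s) f i)%:C = \sum_(i <- s) (f i)%:C.
Proof. exact: (rmorph_sum (@real_complex R)). Qed.

Lemma has_sum_complex (I : choiceType) (f : I -> R) S :
  has_sum f S -> has_sum (fun i => (f i)%:C) S%:C.
Proof.
move=> hS _ /complex_gt0[e e0 ->]; have [A hA] := hS e e0.
exists A => B uB sB; rewrite -sum_complex -rmorphB normc_def /= expr0n /= addr0.
by rewrite sqrtr_sqr ltcR hA.
Qed.

Lemma has_sum_nonneg (I : choiceType) (f : I -> R) (M : R) :
  (forall i, 0 <= f i) ->
  (forall A : seq I, uniq A -> \sum_(i <- A) f i <= M) ->
  exists S, has_sum f S.
Proof.
move=> f0 hM.
pose E := [set x : R | exists2 A : seq I, uniq A & x = \sum_(i <- A) f i]%classic.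
have supE : has_sup E.
  split; first by exists 0; exists [::] => //; rewrite big_nil.
  by exists M => _ [A uA ->]; exact: hM.
exists (sup E) => e e0; have [_ [A uA ->] hA] := sup_adherent e0 supE.
exists A => B uB sB.
have AB : \sum_(i <- A) f i <= \sum_(i <- B) f i by exact: ler_sum_subset.
have BS : \sum_(i <- B) f i <= sup E by apply: ub_le_sup; [case: supE|exists B].
by rewrite ler0_norm ?subr_le0 //; lra.
Qed.

(** Real and imaginary parts are dominated by the modulus. A real family [g] dominated by [N (f i)]
    is the difference of the nonnegative families [N (f i) + g i] and [N (f i)], whose partial sums
    are bounded. *)
Lemma abs_summable_has_sum (I : choiceType) (f : I -> R[i]) :
  abs_summable f -> exists S, has_sum f S.
Proof.
move=> [M hM]; pose N z : R := complex.Re `|z : R[i]|.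
have NE z : `|z| = (N z)%:C by rewrite /N normc_def.
have N0 z : 0 <= N z by rewrite /N normc_def /= sqrtr_ge0.
have ReN z : `|complex.Re z| <= N z by rewrite -lecR -NE normc_ge_Re.
have ImN z : `|complex.Im z| <= N z.
  (* Multiplication by i turns the imaginary part into a real part, up to sign. *)
  have := ReN (z * 'i); rewrite ReiNIm normrN /N normrM [ `|'i| ]normc_def /=.
  by rewrite expr0n expr1n add0r sqrtr1 mulr1 mul0r subr0.
have hN A : uniq A -> \sum_(i <- A) N (f i) <= complex.Re M.
  move=> /hM; under eq_bigr do rewrite NE.
  by rewrite -sum_complex lecE => /andP[].
have H (g : I -> R) : (forall i, `|g i| <= N (f i)) -> exists S, has_sum g S.
  move=> gN; have [S hS] : exists S, has_sum (fun i => N (f i)) S.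
    exact: has_sum_nonneg hN.
  have [T hT] : exists T, has_sum (fun i => N (f i) + g i) T.
    apply: (@has_sum_nonneg _ _ (complex.Re M + complex.Re M)) => [i|A uA].
      by have := gN i; rewrite ler_norml; lra.
    rewrite big_split lerD ?hN //; apply: le_trans (hN A uA).
    by apply: ler_sum => i _; exact: le_trans (ler_norm _) (gN i).
  exists (T - S); apply: has_sum_ext (has_sumB hT hS) => i /=; lra.
have [S hS] := H _ (fun i => ReN (f i)); have [T hT] := H _ (fun i => ImN (f i)).
exists (S%:C + 'i * T%:C).
apply: has_sum_ext (has_sumD (has_sum_complex hS)
  (has_sumZ 'i (has_sum_complex hT))) => i /=.
by rewrite [f i in RHS]complexE.
Qed.

Lemma has_sum_csum (I : choiceType) (f : I -> R[i]) S :
  has_sum f S -> csum f = S.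
Proof.
move=> hS; rewrite /csum /summability.sum.
have FF := @summability.totally_filter I.
apply: (@cvg_lim R[i]^o (@norm_hausdorff _ _)).
apply/cvgrPdist_lt => e e0; have [A hA] := hS e e0.
exists [fset x in A]%fset => // B /= /fsubsetP AB.
rewrite distrC /summability.partial_sum -(big_seq_fsetE _ _ xpredT f) /=.
by apply: hA => [|x xA]; [exact: fset_uniq|apply: AB; rewrite inE].
Qed.

Lemma has_sum_series (u : nat -> R[i]) S :
  has_sum u S -> limn (series (u : nat -> R[i]^o)) = S.
Proof.
move=> hS; apply: (@cvg_lim R[i]^o (@norm_hausdorff _ _)).
apply/cvgrPdist_lt => e e0.
have [A hA] := hS e e0; exists (\max_(i <- A) i).+1 => // m /= Am.
rewrite distrC /series /= hA ?iota_uniq // => i iA.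
rewrite mem_index_iota; apply: leq_ltn_trans Am.
by rewrite (big_rem i) //= leq_maxl.
Qed.

End ComplexSums.

(** * Eisenstein integers *)

Lemma eis_natE (m : nat) : m%:R = Eisenstein m%:Z 0.
Proof.
elim: m => [//|m IH]; rewrite -natr1 IH -addn1 PoszD.
by congr Eisenstein; rewrite ?addr0.
Qed.

Lemma eis_intE (m : int) : m%:~R = Eisenstein m 0.
Proof.
case: m => m; first exact: eis_natE.
by rewrite NegzE mulrNz -pmulrn eis_natE; congr Eisenstein; rewrite oppr0.
Qed.

Definition eis_conj (z : eisenstein) : eisenstein :=
  Eisenstein (eis_re z - eis_om z) (- eis_om z).

Lemma eis_conjK : involutive eis_conj.
Proof. by case=> a b; congr Eisenstein => /=; ring. Qed.

Lemma eis_conjB x y : eis_conj (x - y) = eis_conj x - eis_conj y.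
Proof. by case: x y => [a b] [c d]; congr Eisenstein => /=; ring. Qed.

Lemma eis_conjM x y : eis_conj (x * y) = eis_conj x * eis_conj y.
Proof. by case: x y => [a b] [c d]; congr Eisenstein => /=; ring. Qed.

Lemma eis_conj_nat m : eis_conj m%:R = m%:R.
Proof. by rewrite eis_natE; congr Eisenstein => /=; ring. Qed.

Lemma eis_conj1 : eis_conj 1 = 1.
Proof. exact: (eis_conj_nat 1). Qed.

Lemma eis_conjX x k : eis_conj (x ^+ k) = eis_conj x ^+ k.
Proof. by elim: k => [|k IH]; rewrite ?eis_conj1 // !exprS eis_conjM IH. Qed.

Lemma eis_conj_prod (I : Type) (s : seq I) (F : I -> eisenstein) :
  eis_conj (\prod_(i <- s) F i) = \prod_(i <- s) eis_conj (F i).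
Proof. exact: (big_morph _ eis_conjM eis_conj1). Qed.

Lemma eis_mul_conj z : z * eis_conj z = (eis_norm z)%:~R.
Proof.
by rewrite eis_intE; case: z => a b; congr Eisenstein; rewrite /eis_norm /=; ring.
Qed.

Lemma eis_normM x y : eis_norm (x * y) = eis_norm x * eis_norm y.
Proof. by case: x y => [a b] [c d]; rewrite /eis_norm /=; ring. Qed.

Lemma eis_norm_conj z : eis_norm (eis_conj z) = eis_norm z.
Proof. by case: z => a b; rewrite /eis_norm /=; ring. Qed.

Lemma eis_normN z : eis_norm (- z) = eis_norm z.
Proof. by case: z => a b; rewrite /eis_norm /=; ring. Qed.

Lemma eis_norm1 : eis_norm 1 = 1. Proof. by []. Qed.

Lemma eis_norm_nat m : eis_norm m%:R = m%:Z ^+ 2.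
Proof. by rewrite eis_natE /eis_norm /=; ring. Qed.

Lemma eis_norm_ge0 z : 0 <= eis_norm z.
Proof.
rewrite -(pmulr_rge0 _ (isT : (0 : int) < 4)).
have -> : 4 * eis_norm z = (2 * eis_re z - eis_om z) ^+ 2 + 3 * eis_om z ^+ 2.
  by rewrite /eis_norm; ring.
by apply: addr_ge0; [|apply: mulr_ge0 => //]; exact: sqr_ge0.
Qed.

Lemma eis_norm_eq0 z : (eis_norm z == 0) = (z == 0).
Proof.
apply/eqP/eqP => [h|->//].
have : (2 * eis_re z - eis_om z) ^+ 2 + 3 * eis_om z ^+ 2 == 0.
  by apply/eqP; rewrite -[RHS](mulr0 4) -h /eis_norm; ring.
rewrite paddr_eq0; [|exact: sqr_ge0|by apply: mulr_ge0 => //; exact: sqr_ge0].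
rewrite sqrf_eq0 mulf_eq0 /= sqrf_eq0 subr_eq0.
case: z {h} => a b /= /andP[/eqP h /eqP b0]; rewrite b0 in h *.
by have -> : a = 0 by lia.
Qed.

Lemma eis_norm_gt0 z : (0 < eis_norm z) = (z != 0).
Proof. by rewrite lt_def eis_norm_ge0 andbT eis_norm_eq0. Qed.

Lemma eis_mul_eq0 (x y : eisenstein) : x * y = 0 -> x = 0 \/ y = 0.
Proof.
move/eqP; rewrite -eis_norm_eq0 eis_normM mulf_eq0 !eis_norm_eq0.
by case/orP => /eqP; [left|right].
Qed.

Lemma eis_mulI (z x y : eisenstein) : z <> 0 -> z * x = z * y -> x = y.
Proof.
move=> z0 /eqP; rewrite -subr_eq0 -mulrBr => /eqP/eis_mul_eq0[//|/eqP].
by rewrite subr_eq0 => /eqP.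
Qed.

(** * Divisibility in commutative rings *)

Section Divisibility.
Variable A : comNzRingType.
Implicit Types x y z : A.

Lemma rdvd_refl x : rdvd x x. Proof. by exists 1; rewrite mul1r. Qed.

Lemma rdvd_trans x y z : rdvd x y -> rdvd y z -> rdvd x z.
Proof. by move=> [a ->] [b ->]; exists (b * a); rewrite mulrA. Qed.

Lemma rdvd_mull x y z : rdvd x y -> rdvd x (z * y).
Proof. by move=> [a ->]; exists (z * a); rewrite mulrA. Qed.

Lemma rdvd_mulr x y z : rdvd x y -> rdvd x (y * z).
Proof. by rewrite mulrC; exact: rdvd_mull. Qed.

Lemma rdvdD x y z : rdvd x y -> rdvd x z -> rdvd x (y + z).
Proof. by move=> [a ->] [b ->]; exists (a + b); rewrite mulrDl. Qed.

Lemma rdvdN x y : rdvd x y -> rdvd x (- y).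
Proof. by move=> [a ->]; exists (- a); rewrite mulNr. Qed.

Lemma rdvdB x y z : rdvd x y -> rdvd x z -> rdvd x (y - z).
Proof. by move=> xy /rdvdN; exact: rdvdD. Qed.

Lemma rdvd0 x : rdvd x 0. Proof. by exists 0; rewrite mul0r. Qed.

Lemma rdvd_exp_sub x y z k : rdvd x (y - z) -> rdvd x (y ^+ k - z ^+ k).
Proof. by rewrite subrXX; exact: rdvd_mulr. Qed.

Lemma rdvd_nat (m k : nat) : (m %| k)%N -> rdvd m%:R (k%:R : A).
Proof. by move=> /dvdnP[q ->]; exists q%:R; rewrite natrM. Qed.

(** Splitting off the least prime factor [p] of [m], the prime [x] divides [p] or the smaller
    cofactor; reaching 1 would make [x] a unit. *)
Lemma rprime_nat x m : rprime x -> (0 < m)%N -> rdvd x m%:R ->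
  exists2 p, prime p & (p %| m)%N /\ rdvd x p%:R.
Proof.
move=> [x0 xu xp]; have [k] := ubnP m.
elim: k m => // k IH m /ltnSE mk m0 xm.
have [m1|m1] := leqP m 1.
  by case: xu; move: xm; rewrite (_ : m = 1%N) //; lia.
have pp := pdiv_prime m1; have pm := pdiv_dvd m.
move: (pdiv m) pp pm => p pp pm; have p1 := prime_gt1 pp.
have qm : (m %/ p %| m)%N by apply/dvdnP; exists p; rewrite mulnC divnK.
move: xm; rewrite -{1}(divnK pm) natrM => /xp[xq|]; last by exists p.
have [||//|q qp [qd xq']] := IH (m %/ p)%N.
- exact: leq_trans (ltn_Pdiv p1 m0) mk.
- by rewrite divn_gt0 ?prime_gt0 // dvdn_leq.
by exists q => //; split => //; exact: dvdn_trans qm.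
Qed.

Lemma rdvd_frobenius p x y : prime p ->
  rdvd (p%:R : A) ((x + y) ^+ p - (x ^+ p + y ^+ p)).
Proof.
move=> pp; rewrite exprDn.
case: p pp => // p pp; rewrite big_ord_recr big_ord_recl /=.
rewrite !bin0 binn subnn subn0 !expr0 mulr1 mul1r !mulr1n.
rewrite (_ : _ - _ = \sum_(i < p) x ^+ (p.+1 - bump 0 i) * y ^+ bump 0 i *+
  'C(p.+1, bump 0 i)); last by ring.
apply: (big_ind (rdvd (p.+1%:R : A))) => [||i _]; [exact: rdvd0|exact: rdvdD|].
rewrite -[X in rdvd _ X]mulr_natr; apply/rdvd_mull/rdvd_nat/prime_dvd_bin => //.
by rewrite /bump /= add1n /= ltnS.
Qed.

End Divisibility.

Lemma eis_runitP (z : eisenstein) : runit z <-> eis_norm z = 1.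
Proof.
split=> [[y] /(congr1 eis_norm)|h].
  rewrite eis_norm1 eis_normM => h; have := eis_norm_ge0 z; have := eis_norm_ge0 y.
  move: (eis_norm y) (eis_norm z) h => a b h _ b0.
  have : (b %| 1)%Z by apply/dvdzP; exists a.
  by rewrite dvdz1 => /eqP; lia.
by exists (eis_conj z); rewrite mulrC eis_mul_conj h.
Qed.

Lemma eis_conj_rdvd x y : rdvd x y -> rdvd (eis_conj x) (eis_conj y).
Proof. by move=> [a ->]; exists (eis_conj a); rewrite eis_conjM. Qed.

Lemma eis_conj_rdvdE x y : rdvd (eis_conj x) (eis_conj y) <-> rdvd x y.
Proof.
split=> [|/eis_conj_rdvd//]; by move/eis_conj_rdvd; rewrite !eis_conjK.
Qed.

Lemma eis_conj_rprime x : rprime x -> rprime (eis_conj x).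
Proof.
move=> [x0 xu xp]; split.
- by move/(congr1 eis_conj); rewrite eis_conjK => h; apply: x0; rewrite h.
- by move=> /eis_runitP; rewrite eis_norm_conj => /eis_runitP.
- move=> y z /eis_conj_rdvd; rewrite eis_conjK eis_conjM.
  by case/xp => /eis_conj_rdvd; rewrite eis_conjK; [left|right].
Qed.

Lemma eis_rdvd_nat (m : nat) (z : eisenstein) :
  rdvd m%:R z <-> (m%:Z %| eis_re z)%Z && (m%:Z %| eis_om z)%Z.
Proof.
rewrite eis_natE; split=> [[[a b] ->] /=|/andP[/dvdzP[a ha] /dvdzP[b hb]]].
  by rewrite !mulr0 subr0 add0r subr0 !dvdz_mull // dvdzz.
exists (Eisenstein a b); case: z ha hb => u v /= -> ->.
by congr Eisenstein => /=; ring.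
Qed.

Lemma eis_omega3 : eis_omega ^+ 3 = 1.
Proof. by []. Qed.

Lemma eis_omega_mod k : eis_omega ^+ k = eis_omega ^+ (k %% 3).
Proof.
by rewrite {1}(divn_eq k 3) exprD mulnC exprM eis_omega3 expr1n mul1r.
Qed.

Lemma eis_conj_omega : eis_conj eis_omega = eis_omega ^+ 2.
Proof. by []. Qed.

Lemma eis_omega_unit k : runit (eis_omega ^+ k).
Proof.
apply/eis_runitP; elim: k => [//|k IH].
by rewrite exprS eis_normM IH mulr1.
Qed.

(* z^p = a + b omega^p (mod p), and omega^q only depends on q modulo 3. *)
Lemma eis_fermat (p q : nat) (z : eisenstein) :
  prime p -> q = p \/ q = (p ^ 2)%N -> q = 1 %[mod 3] ->
  rdvd p%:R (z ^+ q - z).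
Proof.
move=> pp hq q3; pose W k := (eis_re z)%:~R + (eis_om z)%:~R * eis_omega ^+ k.
have zE : z = W 1%N.
  rewrite /W expr1 !eis_intE; case: z {W} => a b.
  by congr Eisenstein => /=; ring.
have Fint (a : int) : rdvd (p%:R : eisenstein) (a%:~R ^+ p - a%:~R).
  have /dvdzP[b hb] : (p%:Z %| a ^+ p - a)%Z.
    rewrite -eqz_mod_dvd -modzXm -[X in _ == X]modz_mod.
    have : 0 <= (a %% p)%Z by rewrite modz_ge0 //; case: p pp {hq}.
    case: (a %% p)%Z => // m _.
    by rewrite -(natz m) -natrX !natz !modz_nat fermat_little.
  rewrite -rmorphXn -rmorphB /= hb.
  by exists b%:~R; rewrite rmorphM.
have step k : rdvd (p%:R : eisenstein) (W k ^+ p - W (k * p)%N).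
  rewrite /W; set x := _%:~R; set y := _%:~R.
  have -> : (x + y * eis_omega ^+ k) ^+ p - (x + y * eis_omega ^+ (k * p)) =
    ((x + y * eis_omega ^+ k) ^+ p - (x ^+ p + (y * eis_omega ^+ k) ^+ p)) +
    (x ^+ p - x) + (y ^+ p - y) * eis_omega ^+ (k * p).
    by rewrite [(y * _) ^+ p]exprMn -exprM; ring.
  apply: rdvdD; first apply: rdvdD; [exact: rdvd_frobenius|exact: Fint|].
  by apply: rdvd_mulr; exact: Fint.
have Wmod k : k = 1 %[mod 3] -> W k = z.
  by move=> k3; rewrite [RHS]zE /W eis_omega_mod k3.
case: hq => hq; rewrite hq in q3 *.
  by have := step 1%N; rewrite -zE mul1n Wmod.
(* Two Frobenius steps modulo [p]: the p-th power of z is [W p], and the p-th power of [W p] is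
   W(p^2) = z. *)
have h1 := step 1%N; have h2 := step p.
rewrite -zE mul1n in h1; rewrite mulnn (Wmod _ q3) in h2.
rewrite -mulnn exprM (_ : _ - z = (z ^+ p ^+ p - W p ^+ p) + (W p ^+ p - z));
  last by ring.
by apply: rdvdD; [exact: rdvd_exp_sub|].
Qed.

(** * The cubic residue symbol *)

(** This excludes the primes above 3 and keeps at hand the rational prime modulo which [eis_fermat]
    applies. *)
Definition good_prime (l : eisenstein) : Prop :=
  rprime l /\ exists2 p, prime p & p != 3%N /\ rdvd l p%:R.

Lemma eis_norm_mod3 z : (eis_norm z = 0 %[mod 3] \/ eis_norm z = 1 %[mod 3])%Z.
Proof.
case: z => a b; rewrite /eis_norm /=.
have : ((a + b) ^+ 2 = 0 %[mod 3] \/ (a + b) ^+ 2 = 1 %[mod 3])%Z.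
  rewrite -modzXm; have : (0 <= (a + b) %% 3 < 3)%Z.
    by rewrite modz_ge0 // ltz_pmod.
  case: ((a + b) %% 3)%Z => [[|[|[|]]]|] //= _; by [left|right|right].
have -> : a ^+ 2 - a * b + b ^+ 2 = (- (a * b)) * 3 + (a + b) ^+ 2 by ring.
by rewrite modzMDl.
Qed.

(** As [l] divides [p], its norm divides p^2 and is not 1. Norms are 0 or 1 modulo 3, and a norm
    divisible by 3 would force p = 3. *)
Lemma good_prime_norm l : good_prime l -> exists p,
  [/\ prime p, rdvd l p%:R, `|eis_norm l|%N = p \/ `|eis_norm l|%N = (p ^ 2)%N
    & `|eis_norm l|%N = 1 %[mod 3]].
Proof.
move=> [[l0 lu lp] [p pp [p3 lp']]]; exists p; split => //.
  have [y yE] := lp'; have : (`|eis_norm l| %| p ^ 2)%N.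
    have := congr1 eis_norm yE; rewrite eis_norm_nat eis_normM.
    move/(congr1 absz); rewrite abszX abszM => ->; exact: dvdn_mull.
  move=> /(dvdn_pfactor _ _ pp)[[|[|[|k]]] // _ lE].
  - case: lu; apply/eis_runitP; have := eis_norm_ge0 l; lia.
  - by left; rewrite lE expn1.
  - by right.
have [y yE] := lp'; have {}yE := congr1 eis_norm yE.
rewrite eis_norm_nat eis_normM in yE.
have := eis_norm_mod3 l; have := eis_norm_ge0 l.
case: (eis_norm l) yE => // m yE _ [] h; last by lia.
suff : (3 %| p)%N by rewrite dvdn_prime2 // eq_sym (negPf p3).
have : (3 %| p%:Z ^+ 2)%Z by rewrite yE; apply/dvdz_mull/dvdz_mod0P.
by rewrite dvdzE abszX Euclid_dvdX // andbT.
Qed.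

Lemma good_prime_ndvd3 l : good_prime l -> ~ rdvd l 3%:R.
Proof.
move=> [[l0 lu lp] [p pp [p3 lpp]]] l3; apply: lu.
have /(@coprimeP _ _ (prime_gt0 pp))[[u v] /= h] : coprime p 3.
  by rewrite prime_coprime // dvdn_prime2.
rewrite /runit -[1]/(1%:R) -h natrB; last by lia.
by rewrite !natrM; apply: rdvdB; exact: rdvd_mull.
Qed.

(** A difference of two distinct cube roots of unity divides 3, and [l] does not. *)
Lemma omega_exp_inj l j k : good_prime l ->
  rdvd l (eis_omega ^+ j - eis_omega ^+ k) ->
  eis_omega ^+ j = eis_omega ^+ k.
Proof.
move=> gl; rewrite (eis_omega_mod j) (eis_omega_mod k).
have j3 : (j %% 3 < 3)%N by rewrite ltn_mod.
have k3 : (k %% 3 < 3)%N by rewrite ltn_mod.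
move: (j %% 3)%N (k %% 3)%N j3 k3 => [|[|[|//]]] [|[|[|//]]] // _ _ h;
  case: (good_prime_ndvd3 gl).
- by rewrite (_ : 3%:R = (1 - eis_omega ^+ 2) *
    (eis_omega ^+ 0 - eis_omega ^+ 1)) //; exact: rdvd_mull.
- by rewrite (_ : 3%:R = (1 - eis_omega) *
    (eis_omega ^+ 0 - eis_omega ^+ 2)) //; exact: rdvd_mull.
- by rewrite (_ : 3%:R = (eis_omega ^+ 2 - 1) *
    (eis_omega ^+ 1 - eis_omega ^+ 0)) //; exact: rdvd_mull.
- by rewrite (_ : 3%:R = (eis_omega ^+ 2 - eis_omega) *
    (eis_omega ^+ 1 - eis_omega ^+ 2)) //; exact: rdvd_mull.
- by rewrite (_ : 3%:R = (eis_omega - 1) *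
    (eis_omega ^+ 2 - eis_omega ^+ 0)) //; exact: rdvd_mull.
- by rewrite (_ : 3%:R = (eis_omega - eis_omega ^+ 2) *
    (eis_omega ^+ 2 - eis_omega ^+ 1)) //; exact: rdvd_mull.
Qed.

Local Notation cubic_exp l := ((`|eis_norm l|%N - 1) %/ 3)%N.

Lemma cubic_residue0 l z : rdvd l z -> cubic_residue l z = 0.
Proof. by move=> h; rewrite /cubic_residue; case: asboolP. Qed.

(** The fallback 0 of the [pick] is never reached: with x = z^((N(l) - 1)/3), Fermat makes [l]
    divide x^3 - 1 = (x - 1)(x - omega)(x - omega^2), hence one of the factors. *)
Lemma cubic_residue_spec l z : good_prime l -> ~ rdvd l z ->
  exists2 k, cubic_residue l z = eis_omega ^+ k &
    rdvd l (z ^+ cubic_exp l - eis_omega ^+ k).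
Proof.
move=> gl lz; rewrite /cubic_residue; case: asboolP => // _.
case: pickP => [k /asboolP h|none]; first by exists k.
have [[l0 lu lp] _] := gl; have [p [pp lpp hN N3]] := good_prime_norm gl.
exfalso.
have hF : rdvd l (z ^+ `|eis_norm l|%N - z).
  exact: rdvd_trans lpp (eis_fermat z pp hN N3).
set m := cubic_exp l in none.
have NE : `|eis_norm l|%N = (m * 3).+1.
  by rewrite /m; move: N3; lia.
move: hF; rewrite NE exprS -[X in _ - X]mulr1 -mulrBr => /lp[//|].
rewrite exprM; set x := z ^+ m.
have -> : x ^+ 3 - 1 =
    (x - eis_omega ^+ 0) * ((x - eis_omega ^+ 1) * (x - eis_omega ^+ 2)).
  have -> : (x - eis_omega ^+ 0) * ((x - eis_omega ^+ 1) * (x - eis_omega ^+ 2)) =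
    x ^+ 3 - (1 + eis_omega + eis_omega ^+ 2) * x ^+ 2 +
    (eis_omega ^+ 3 + eis_omega + eis_omega ^+ 2) * x - eis_omega ^+ 3 by ring.
  rewrite eis_omega3 (_ : 1 + eis_omega + eis_omega ^+ 2 = 0) //.
  by rewrite !mul0r subr0 addr0.
have np (k : 'I_3) : ~ rdvd l (x - eis_omega ^+ k).
  by move=> h; have := none k; case: asboolP.
by case/lp => [/(np 0)//|/lp[/(np 1)//|/(np 2)//]].
Qed.

Lemma cubic_residue_eq l z k : good_prime l -> ~ rdvd l z ->
  rdvd l (z ^+ cubic_exp l - eis_omega ^+ k) ->
  cubic_residue l z = eis_omega ^+ k.
Proof.
move=> gl lz hk; have [j -> hj] := cubic_residue_spec gl lz.
apply: (omega_exp_inj gl).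
by have := rdvdB hk hj; rewrite opprB addrC addrA subrK.
Qed.

Lemma cubic_residueM l x y : good_prime l ->
  cubic_residue l (x * y) = cubic_residue l x * cubic_residue l y.
Proof.
move=> gl; have [[l0 lu lp] _] := gl.
have [lx|lx] := pselect (rdvd l x).
  by rewrite [in RHS]cubic_residue0 // mul0r cubic_residue0 //; exact: rdvd_mulr.
have [ly|ly] := pselect (rdvd l y).
  rewrite [cubic_residue l y]cubic_residue0 // mulr0 cubic_residue0 //.
  exact: rdvd_mull.
have [i -> hi] := cubic_residue_spec gl lx.
have [j -> hj] := cubic_residue_spec gl ly.
rewrite -exprD; apply: cubic_residue_eq => //; first by case/lp.
rewrite exprMn exprD.
have -> (a b u v : eisenstein) : a * b - u * v = (a - u) * b + u * (b - v).
  by ring.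
by apply: rdvdD; [exact: rdvd_mulr|exact: rdvd_mull].
Qed.

Lemma cubic_residue_unit l z : good_prime l -> runit z -> exists k,
  cubic_residue l z = eis_omega ^+ k.
Proof.
move=> gl uz; have lz : ~ rdvd l z.
  by move=> h; have [[_ lu _] _] := gl; apply: lu; exact: rdvd_trans uz.
by have [k] := cubic_residue_spec gl lz; exists k.
Qed.

(** -1 is its own cube, and the cube of a cube root of unity is 1. *)
Lemma cubic_residueN1 l : good_prime l -> cubic_residue l (-1) = 1.
Proof.
move=> gl; have u1 : runit (-1 : eisenstein) by apply/eis_runitP.
have [k hk] := cubic_residue_unit gl u1.
have -> : -1 = (-1) * ((-1) * (-1)) :> eisenstein by [].
rewrite !cubic_residueM // hk -!expr2 -exprS -exprM mulnC exprM.
by rewrite eis_omega3 expr1n.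
Qed.

Lemma cubic_residue_omega l : good_prime l ->
  cubic_residue l eis_omega = eis_omega ^+ cubic_exp l.
Proof.
move=> gl; apply: cubic_residue_eq => //; last by rewrite subrr; exact: rdvd0.
move=> h; have [[_ lu _] _] := gl; apply: lu.
by apply: rdvd_trans h _; exact: (eis_omega_unit 1).
Qed.

Lemma good_prime_conj l : good_prime l -> good_prime (eis_conj l).
Proof.
move=> [lp [p pp [p3 lpp]]]; split; first exact: eis_conj_rprime.
by exists p => //; split => //; rewrite -(eis_conj_nat p); exact: eis_conj_rdvd.
Qed.

Lemma cubic_residue_conj l z : good_prime l ->
  cubic_residue (eis_conj l) (eis_conj z) = eis_conj (cubic_residue l z).
Proof.
move=> gl; have [lz|lz] := pselect (rdvd l z).
  by rewrite !cubic_residue0 //; exact: eis_conj_rdvd.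
have [k -> hk] := cubic_residue_spec gl lz.
rewrite eis_conjX eis_conj_omega -exprM; apply: cubic_residue_eq.
- exact: good_prime_conj.
- by move/eis_conj_rdvdE.
- rewrite eis_norm_conj exprM -eis_conj_omega -!eis_conjX -eis_conjB.
  exact: eis_conj_rdvd.
Qed.

(** Needed because conjugation matches the primes of [n] only up to units. The symbol depends on [l]
    only through its norm and divisibility by it, which ignore units. *)
Lemma cubic_residue_assoc l m z : rassoc l m ->
  cubic_residue l z = cubic_residue m z.
Proof.
move=> [u uu mE].
have dE x : rdvd l x <-> rdvd m x.
  have [v vE] := uu; split => -[a ->].
    by exists (a * v); rewrite mE mulrA -(mulrA a) -vE mulr1.
  by exists (a * u); rewrite mE mulrA.
have NE : eis_norm m = eis_norm l.
  by rewrite mE eis_normM (proj1 (eis_runitP u) uu) mul1r.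
rewrite /cubic_residue NE (asbool_equiv_eq (dE z)); case: ifP => // _.
congr (if _ is Some k then _ else _); apply: eq_pick => k.
exact: asbool_equiv_eq.
Qed.

Lemma rprime_assoc (x y : eisenstein) : rprime x -> rprime y -> rdvd x y ->
  rassoc x y.
Proof.
move=> [x0 xu xp] [y0 yu yp] [a yE]; exists a => //.
have /yp[] : rdvd y (a * x) by rewrite -yE; exact: rdvd_refl.
  move=> [b aE]; case: xu; exists b; apply: (eis_mulI y0).
  by rewrite mulr1 {1}yE aE; ring.
move=> [b xE]; exists b; apply: (eis_mulI y0).
by rewrite mulr1 {1}yE {1}xE; ring.
Qed.

Lemma rprime_dvd_prod (x : eisenstein) (s : seq eisenstein) : rprime x ->
  rdvd x (\prod_(y <- s) y) -> exists2 y, y \in s & rdvd x y.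
Proof.
move=> [x0 xu xp]; elim: s => [|y s IH]; first by rewrite big_nil => /xu.
rewrite big_cons => /xp[xy|/IH[z zs xz]]; first by exists y; rewrite ?mem_head.
by exists z => //; rewrite in_cons zs orbT.
Qed.

(** Unique factorization without counting multiplicities. Letting the two products differ by a unit
    keeps the induction going once a matched pair of associates has been cancelled. *)
Lemma prod_prime_assoc (phi : eisenstein -> eisenstein) :
  (forall x y, rassoc x y -> phi x = phi y) ->
  forall xs ys : seq eisenstein,
  (forall x, x \in xs -> rprime x) -> (forall y, y \in ys -> rprime y) ->
  rassoc (\prod_(x <- xs) x) (\prod_(y <- ys) y) ->
  \prod_(x <- xs) phi x = \prod_(y <- ys) phi y.
Proof.
move=> phiE; elim=> [|x xs IH] ys px py [u uu].
  case: ys py => [|y ys] py; first by rewrite !big_nil.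
  rewrite big_nil mulr1 big_cons => h.
  have [_ yu _] := py y (mem_head _ _); case: yu.
  by apply: rdvd_trans uu; rewrite -h; exact/rdvd_mulr/rdvd_refl.
rewrite big_cons => h; have xp := px x (mem_head _ _); have [x0 _ _] := xp.
have [|y yys xy] := rprime_dvd_prod (s := ys) xp.
  by rewrite h; apply/rdvd_mull/rdvd_mulr/rdvd_refl.
have axy := rprime_assoc xp (py y yys) xy.
have pr := perm_to_rem yys.
rewrite big_cons [RHS](perm_big _ pr) big_cons -(phiE _ _ axy); congr (_ * _).
apply: IH => [z zx|z zy|].
- by apply: px; rewrite in_cons zx orbT.
- by apply: py; exact: mem_rem zy.
have [a [b abE] yE] := axy; have [v uv] := uu.
exists (b * u).
  exists (v * a); transitivity ((b * a) * (v * u)); last by ring.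
  by rewrite -abE -uv mulr1.
move: h; rewrite (perm_big _ pr) big_cons /= {1}yE.
move: (\prod_(j <- rem y ys) j) => q h; apply: (eis_mulI x0).
transitivity (b * (a * x * q)); last by rewrite h; ring.
by rewrite -[LHS]mul1r abE; ring.
Qed.

Lemma runit_dvd_prod (s : seq eisenstein) x :
  (forall l, l \in s -> rprime l) -> (forall l, l \in s -> ~ rdvd l x) ->
  rdvd x (\prod_(l <- s) l) -> runit x.
Proof.
elim: s => [|l s IH] ps ds; first by rewrite big_nil.
have [l0 lu lp] := ps l (mem_head _ _).
rewrite big_cons => -[y yE]; apply: IH => [z zs|z zs|].
- by apply: ps; rewrite in_cons zs orbT.
- by apply: ds; rewrite in_cons zs orbT.
have /lp[|/(ds l (mem_head _ _))//] : rdvd l (y * x).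
  by rewrite -yE; apply/rdvd_mulr/rdvd_refl.
move=> [z zE]; exists z; apply: (eis_mulI l0).
by rewrite yE zE; ring.
Qed.

(** * The cubic character of a factorization of [n] *)

Section CubicCharacter.
Variables (n r : nat) (lam : 'I_r -> eisenstein) (c : 'I_r -> nat).
Hypotheses (n_gt0 : (0 < n)%N) (n3 : coprime n 3).
Hypothesis fac : prime_factorization n%:R lam c.

(** The primes repeated according to multiplicity: exponents disappear, and the list form fits
    [prod_prime_assoc]. *)
Let s := flatten [seq nseq (c i) (lam i) | i <- enum 'I_r].
Local Notation chi := (cubic_residue_prod lam c).

Let prod_s (F : eisenstein -> eisenstein) :
  \prod_(l <- s) F l = \prod_i F (lam i) ^+ c i.
Proof.
rewrite big_flatten big_map big_enum /=; apply: eq_bigr => i _.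
by rewrite big_nseq iter_mulr_1.
Qed.

Let prod_sE : \prod_(l <- s) l = n%:R.
Proof. by have [_ _ _ ->] := fac; rewrite prod_s. Qed.

Let s_good l : l \in s -> good_prime l.
Proof.
move=> ls; have [lamp cpos _ _] := fac.
have [i lE] : exists i, l = lam i.
  move/flattenP: (ls) => [_ /mapP[i _ ->]] /nseqP[-> _]; by exists i.
have pl : rprime l by rewrite lE.
split=> //; have ln : rdvd l n%:R.
  by rewrite -prod_sE (big_rem l) //=; apply/rdvd_mulr/rdvd_refl.
have [p pp [pn lp]] := rprime_nat pl n_gt0 ln.
exists p => //; split=> //; apply/eqP => p3.
by move: n3; rewrite coprime_sym prime_coprime // => /negP; apply; rewrite -p3.
Qed.

Let chiE z : chi z = \prod_(l <- s) cubic_residue l z.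
Proof. by rewrite prod_s. Qed.

Lemma cubic_residue_prodM x y : chi (x * y) = chi x * chi y.
Proof.
rewrite !chiE -big_split; apply: eq_big_seq => l ls.
exact: cubic_residueM (s_good ls).
Qed.

Lemma cubic_residue_prodN x : chi (- x) = chi x.
Proof.
rewrite -mulN1r cubic_residue_prodM chiE big1_seq ?mul1r // => l /= ls.
exact: cubic_residueN1 (s_good ls).
Qed.

(** As [n] is rational, the conjugated list [map eis_conj s] is again a prime factorization of
    [n]. *)
Lemma cubic_residue_prod_conj x : chi (eis_conj x) = eis_conj (chi x).
Proof.
rewrite !chiE eis_conj_prod.
transitivity (\prod_(l <- map eis_conj s) cubic_residue l (eis_conj x)).
  apply: prod_prime_assoc => [l m|l /s_good[]//|l|].
  - exact: cubic_residue_assoc.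
  - by case/mapP => m /s_good[mp _] ->; exact: eis_conj_rprime.
  - exists 1; first exact: rdvd_refl.
    by rewrite mul1r big_map -eis_conj_prod prod_sE eis_conj_nat.
rewrite big_map; apply: eq_big_seq => l ls.
exact: cubic_residue_conj (s_good ls).
Qed.

Lemma cubic_residue_prod_unit x : (forall l, l \in s -> ~ rdvd l x) ->
  exists k, chi x = eis_omega ^+ k.
Proof.
rewrite chiE; elim: (s) s_good => [|l t IH] gt lx.
  by exists 0%N; rewrite big_nil.
have [||k hk] := IH.
- by move=> m mt; apply: gt; rewrite in_cons mt orbT.
- by move=> m mt; apply: lx; rewrite in_cons mt orbT.
have [j hj _] := cubic_residue_spec (gt l (mem_head _ _)) (lx l (mem_head _ _)).
by exists (j + k)%N; rewrite big_cons hj hk exprD.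
Qed.

Lemma cubic_residue_prod0 x l : l \in s -> rdvd l x -> chi x = 0.
Proof.
by move=> ls lx; rewrite chiE (big_rem l) //= cubic_residue0 ?mul0r.
Qed.

Lemma cubic_residue_prod_val x : chi x = 0 \/ exists k, chi x = eis_omega ^+ k.
Proof.
have [[l ls lx]|no] := pselect (exists2 l, l \in s & rdvd l x).
  by left; exact: cubic_residue_prod0 lx.
right; apply: cubic_residue_prod_unit => l ls lx; apply: no; by exists l.
Qed.

(** For z = 1 (mod 3) the cut-off in [cubic_char] is automatic: a common divisor of z and 3n divides
    n = nz - n(z - 1), so it is a unit unless some prime of [s] divides z, and then the product
    vanishes anyway. *)
Lemma cubic_char_prod z : rdvd 3%:R (z - 1) -> cubic_char n lam c z = chi z.
Proof.
move=> z1; rewrite /cubic_char; case: asboolP => // ncop.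
apply/esym; have [[l ls lz]|no] := pselect (exists2 l, l \in s & rdvd l z).
  exact: cubic_residue_prod0 lz.
case: ncop => x xz x3n; apply: (@runit_dvd_prod s) => [l /s_good[]//|l ls lx|].
  by apply: no; exists l => //; exact: rdvd_trans xz.
rewrite prod_sE; have -> : n%:R = n%:R * z - n%:R * (z - 1) :> eisenstein by ring.
apply: rdvdB; first exact: rdvd_mull.
have [y ->] := z1; rewrite mulrC -mulrA -natrM; exact: rdvd_mull.
Qed.

(** If [m] is prime to [n], the value is a cube root of unity fixed by conjugation, hence 1.
    Otherwise a rational prime common to [m] and [n] is a nonunit dividing [n], so some prime of [s]
    divides it. *)
Lemma cubic_residue_prod_nat m : chi m%:R = (coprime m n)%:R.
Proof.
have [cop|ncop] := boolP (coprime m n).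
  have [|k hk] := @cubic_residue_prod_unit m%:R.
    move=> l ls lm; have [[_ lu _] _] := s_good ls; apply: lu.
    (* The Bezout relation requires m > 0. For m = 0 coprimality means n = 1, and [l] would be a
       unit. *)
    have [m0|m_gt0] := posnP m.
      move: cop lm; rewrite m0 /coprime gcd0n => /eqP n1 _.
      have : rdvd l n%:R.
        by rewrite -prod_sE (big_rem l) //=; apply/rdvd_mulr/rdvd_refl.
      by rewrite n1.
    have /(coprimeP _ m_gt0)[[u v] /= h] := cop.
    rewrite /runit -[1]/(1%:R) -h natrB; last by lia.
    rewrite !natrM; apply: rdvdB; apply: rdvd_mull => //.
    by rewrite -prod_sE (big_rem l) //=; apply/rdvd_mulr/rdvd_refl.
  have := cubic_residue_prod_conj m%:R; rewrite eis_conj_nat hk eis_omega_mod.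
  have : (k %% 3 < 3)%N by rewrite ltn_mod.
  by case: (k %% 3)%N => [|[|[|]]].
have g1 : (1 < gcdn m n)%N.
  by have := gcdn_gt0 m n; rewrite n_gt0 orbT; move: ncop; rewrite /coprime; lia.
have pp := pdiv_prime g1; have := pdiv_dvd (gcdn m n).
move: (pdiv _) pp => p pp; rewrite dvdn_gcd => /andP[pm pn].
have [[l ls lp]|no] := pselect (exists2 l, l \in s & rdvd l p%:R).
  apply: cubic_residue_prod0 ls _; apply: rdvd_trans lp _; exact: rdvd_nat.
have : runit (p%:R : eisenstein).
  apply: (@runit_dvd_prod s) => [l /s_good[]//|l ls lx|].
    by apply: no; exists l.
  by rewrite prod_sE; exact: rdvd_nat.
move/eis_runitP; rewrite eis_norm_nat => h.
by have := prime_gt1 pp; move: h; rewrite expr2; nia.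
Qed.

(** The symbol of omega at l is omega^((N(l) - 1)/3). Since (1 + 3e)(1 + 3k) = 1 + 3(e + k) modulo
    9, the total exponent [k] is read off from N(n) = n^2 = 1 + 3k modulo 9. If 3 divided [k], then
    n^2 would be 1 modulo 9, whose only square roots are 1 and -1. *)
Lemma cubic_residue_prod_omega :
  (n%:Z != 1 %[mod 9])%Z -> (n%:Z != -1 %[mod 9])%Z ->
  chi eis_omega = eis_omega \/ chi eis_omega = eis_omega ^+ 2.
Proof.
move=> n1 n8.
have [k [hk nk]] : exists k, chi eis_omega = eis_omega ^+ k /\
    (n ^ 2 = 1 + 3 * k %[mod 9])%N.
  have -> : (n ^ 2 = `|eis_norm n%:R|)%N by rewrite eis_norm_nat abszX.
  rewrite chiE -prod_sE; elim: (s) s_good => [|l t IH] gt.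
    by exists 0%N; rewrite !big_nil.
  have [|k [hk nk]] := IH.
    by move=> m mt; apply: gt; rewrite in_cons mt orbT.
  have gl := gt l (mem_head _ _); exists (cubic_exp l + k)%N.
  rewrite !big_cons hk cubic_residue_omega // exprD; split => //.
  rewrite eis_normM abszM -modnMmr nk modnMmr.
  have [p [_ _ _ N3]] := good_prime_norm gl.
  have [e eE] : exists e, `|eis_norm l|%N = (1 + 3 * e)%N.
    by exists (cubic_exp l); move: N3; lia.
  rewrite eE (_ : (_ - 1) %/ 3 = e)%N; last by lia.
  rewrite (_ : (_ * _ = (e * k) * 9 + (1 + 3 * (e + k)))%N); last by lia.
  by rewrite modnMDl.
rewrite hk eis_omega_mod; have : (k %% 3 < 3)%N by rewrite ltn_mod.
have : (k %% 3 != 0)%N.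
  apply/eqP => k0; move: nk; rewrite -modnXm.
  have : (n %% 9 < 9)%N by rewrite ltn_mod.
  have : (n %% 9 != 1)%N by lia.
  have : (n %% 9 != 8)%N by lia.
  have -> : ((1 + 3 * k) %% 9 = 1)%N by lia.
  by case: (n %% 9)%N => [|[|[|[|[|[|[|[|[|]]]]]]]]].
case: (k %% 3)%N => [|[|[|]]] // _ _; first by left.
by right.
Qed.

End CubicCharacter.

(** * Complex powers and power sums *)

Section ComplexPowers.
Variable R : realType.
Implicit Types (s z : R[i]) (x y : R).

Lemma cexpD z w : cexp (z + w) = cexp z * cexp w :> R[i].
Proof.
case: z w => [a b] [c d]; rewrite /cexp /= expRD cosD sinD.
by apply/eqP; rewrite eq_complex /=; apply/andP; split; apply/eqP; ring.
Qed.

Lemma cexp0 : cexp 0 = 1 :> R[i].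
Proof. by rewrite /cexp /= expR0 cos0 sin0 mul1r. Qed.

Lemma cpowM x y s : 0 < x -> 0 < y -> cpow (x * y) s = cpow x s * cpow y s.
Proof. by move=> x0 y0; rewrite /cpow lnM // rmorphD mulrDr cexpD. Qed.

Lemma cpow1 s : cpow 1 s = 1 :> R[i].
Proof. by rewrite /cpow ln1 mulr0 cexp0. Qed.

Lemma cpowDr x s z : cpow x (s + z) = cpow x s * cpow x z.
Proof. by rewrite /cpow mulrDl cexpD. Qed.

Lemma cpow_inv x s : 0 < x -> cpow x^-1 s = cpow x (- s).
Proof. by move=> x0; rewrite /cpow lnV // rmorphN mulrN mulNr. Qed.

Lemma cpow_sqr x s : 0 < x -> cpow (x ^+ 2) s = cpow x (2 * s).
Proof. by move=> x0; rewrite expr2 cpowM // -cpowDr; congr cpow; ring. Qed.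

Lemma norm_cexp z : `|cexp z| = (expR (complex.Re z))%:C.
Proof.
rewrite /cexp normrM [ `|cos _ +i* _| ]normc_def /= cos2Dsin2 sqrtr1 mulr1.
by rewrite ger0_norm // lecR expR_ge0.
Qed.

Lemma norm_cpow x s : 0 < x -> `|cpow x s| = (x `^ complex.Re s)%:C.
Proof.
move=> x0; rewrite norm_cexp /powR gt_eqF //; case: s => a b /=.
by rewrite mulr0 subr0.
Qed.

Lemma omegaE : omega R = (- 2^-1) +i* (Num.sqrt 3 / 2).
Proof.
have pi0 := pi_gt0 R.
have s0 : 0 < sin (pi / 3 : R) by apply: sin_gt0_pi; apply/andP; split; lra.
(* Comparing sin(2 pi/3) = sin(pi/3) with the duplication formula gives 2 cos(pi/3) = 1. *)
have c12 : cos (pi / 3 : R) = 2^-1.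
  have : sin (pi / 3 *+ 2 : R) = sin (pi / 3).
    rewrite (_ : pi / 3 *+ 2 = - (pi / 3) + pi); last by rewrite mulr2n; lra.
    by rewrite sinDpi sinN opprK.
  rewrite sin_mulr2n mulr2n -mulrDl -[RHS]mul1r => /(mulIf (lt0r_neq0 s0)); lra.
have s2 : sin (pi / 3 : R) = Num.sqrt 3 / 2.
  have := cos2Dsin2 (pi / 3 : R); rewrite c12 => h.
  apply: (@pexpIrn _ 2) => //; rewrite ?nnegrE ?ltW // ?divr_ge0 ?sqrtr_ge0 //.
  rewrite expr_div_n sqr_sqrtr //; lra.
rewrite /omega /cexp /= !mul0r !subr0 !mulr0 !mulr1 ?subr0 ?addr0 ?add0r.
rewrite expR0 mul1r (_ : 2 * pi / 3 = - (pi / 3) + pi); last by lra.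
by rewrite cosDpi sinDpi cosN sinN opprK c12 s2.
Qed.

Lemma omega_sqr : omega R ^+ 2 = - 1 - omega R.
Proof.
rewrite omegaE expr2; apply/eqP; rewrite eq_complex /=.
have h : Num.sqrt 3 * Num.sqrt 3 = 3 :> R by rewrite -expr2 sqr_sqrtr.
by apply/andP; split; apply/eqP; lra.
Qed.

Local Notation eis_val := (@eis_val R).

Lemma eis_valM (x y : eisenstein) : eis_val (x * y) = eis_val x * eis_val y.
Proof.
rewrite /eis_val /= !(rmorphB, rmorphD, rmorphM) /=.
transitivity ((eis_re x)%:~R * (eis_re y)%:~R
  + ((eis_re x)%:~R * (eis_om y)%:~R + (eis_om x)%:~R * (eis_re y)%:~R) * omega R
  + (eis_om x)%:~R * (eis_om y)%:~R * omega R ^+ 2); last by ring.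
by rewrite omega_sqr; ring.
Qed.

Lemma eis_val0 : eis_val 0 = 0. Proof. by rewrite /eis_val mul0r addr0. Qed.

Lemma eis_val1 : eis_val 1 = 1. Proof. by rewrite /eis_val mul0r addr0. Qed.

Lemma eis_val_omega : eis_val eis_omega = omega R.
Proof. by rewrite /eis_val /= add0r mul1r. Qed.

Lemma eis_valX (x : eisenstein) k : eis_val (x ^+ k) = eis_val x ^+ k.
Proof. by elim: k => [|k IH]; rewrite ?eis_val1 // !exprS eis_valM IH. Qed.

Lemma eis_valE (z : eisenstein) : eis_val z = ((eis_re z)%:~R - (eis_om z)%:~R / 2) +i*
  ((eis_om z)%:~R * (Num.sqrt 3 / 2)).
Proof.
have cI (m : int) : m%:~R = (m%:~R : R)%:C by rewrite rmorph_int.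
rewrite /eis_val omegaE !cI; apply/eqP; rewrite eq_complex /=.
by apply/andP; split; apply/eqP; ring.
Qed.

Lemma eis_val_conj (z : eisenstein) : eis_val (eis_conj z) = (eis_val z)^*.
Proof.
rewrite !eis_valE /= !rmorphB rmorphN /=; apply/eqP; rewrite eq_complex /=.
by apply/andP; split; apply/eqP; lra.
Qed.

Lemma norm_eis_val (z : eisenstein) : `|eis_val z| ^+ 2 = (eis_norm z)%:~R.
Proof.
rewrite sqr_normc -eis_val_conj -eis_valM eis_mul_conj eis_intE /eis_val /=.
by rewrite mul0r addr0.
Qed.

Lemma Re_norm_eis_val (z : eisenstein) :
  complex.Re `|eis_val z| ^+ 2 = (eis_norm z)%:~R.
Proof.
have : (complex.Re `|eis_val z| ^+ 2)%:C = ((eis_norm z)%:~R : R)%:C.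
  have nE : `|eis_val z| = (complex.Re `|eis_val z|)%:C by rewrite normc_def.
  by rewrite rmorph_int -norm_eis_val [in RHS]nE -rmorphXn.
by move/(congr1 (@complex.Re _)).
Qed.

Lemma eis_val_eq0 (z : eisenstein) : (eis_val z == 0) = (z == 0).
Proof.
by rewrite -normr_eq0 -sqrf_eq0 norm_eis_val intr_eq0 eis_norm_eq0.
Qed.

Lemma cpow_norm_eis (z : eisenstein) s : z != 0 ->
  cpow (complex.Re `|eis_val z|) (- (2 * s)) = cpow (eis_norm z)%:~R (- s).
Proof.
move=> z0; rewrite -mulrN -cpow_sqr ?Re_norm_eis_val //.
have : 0 < `|eis_val z| by rewrite normr_gt0 eis_val_eq0.
by rewrite ltcE => /andP[].
Qed.

End ComplexPowers.

Section PowerSums.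
Variable R : realType.

Lemma powR_antimono (a x y : R) : 0 <= a -> 0 < x -> x <= y ->
  y `^ (- a) <= x `^ (- a).
Proof.
move=> a0 x0 xy; have y0 := lt_le_trans x0 xy.
rewrite !powRN lef_pV2 ?posrE ?powR_gt0 //.
by apply: ge0_ler_powR => //; rewrite nnegrE ltW.
Qed.

Lemma powR_lt1 (x b : R) : 1 < x -> b < 0 -> x `^ b < 1.
Proof.
move=> x1 b0; rewrite /powR gt_eqF ?(lt_trans _ x1) // expR_lt1.
by rewrite nmulr_rlt0 // ln_gt0.
Qed.

Definition power_partial_sum (a : R) (N : nat) : R :=
  \sum_(i < N) i.+1%:R `^ (- a).

(* Grouping the terms 2m and 2m+1 bounds T(2N+1) by 1 + 2^(1-a) T(N), and
   T(N) <= T(2N+1). *)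
Lemma power_partial_sum_bound (a : R) N : 1 < a ->
  power_partial_sum a N <= (1 - 2 `^ (1 - a))^-1.
Proof.
move=> a1; set T := power_partial_sum a; set q := 2 `^ (1 - a).
have a0 : 0 <= a by lra.
have q1 : q < 1 by apply: powR_lt1; rewrite ?ltr1n ?subr_lt0.
have dbl M : T (M.*2.+1) <= 1 + q * T M.
  elim: M => [|M IH].
    by rewrite /T /power_partial_sum big_ord1 big_ord0 powR1 mulr0 addr0.
  rewrite /T /power_partial_sum doubleS !big_ord_recr /= in IH *.
  rewrite mulrDr addrA -addrA; apply: lerD => //.
  have M0 : 0 < M.+1%:R :> R by rewrite ltr0n.
  have E : (M.*2.+2)%:R `^ (- a) = 2 `^ (- a) * M.+1%:R `^ (- a) :> R.
    by rewrite -powRM ?ler0n // -natrM mul2n doubleS.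
  have -> : q * M.+1%:R `^ (- a) = (M.*2.+2)%:R `^ (- a) + (M.*2.+2)%:R `^ (- a).
    rewrite E /q powRD; last by rewrite pnatr_eq0 implybT.
    by rewrite powRr1 ?ler0n //; ring.
  rewrite lerD2l; by apply: powR_antimono => //; rewrite ler_nat.
have mono : T N <= T (N.*2.+1).
  have NN : (N <= N.*2.+1)%N by lia.
  rewrite /T /power_partial_sum (big_ord_widen _ (fun i => i.+1%:R `^ (- a)) NN).
  by rewrite big_mkcond /=; apply: ler_sum => i _; case: ifP.
rewrite -[leRHS]mul1r ler_pdivlMr ?subr_gt0 //.
by have := dbl N; lra.
Qed.

Lemma abs_summable_nat_power (a : R) : 1 < a ->
  abs_summable (fun m : nat => m.+1%:R `^ (- a) : R).
Proof.
move=> a1; exists (1 - 2 `^ (1 - a))^-1 => A uA.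
under eq_bigr do rewrite ger0_norm //.
pose N := (\max_(i <- A) i).+1.
apply: le_trans (power_partial_sum_bound N a1).
rewrite /power_partial_sum -(big_mkord xpredT (fun i => i.+1%:R `^ (- a))).
apply: ler_sum_subset => [i|||i iA] //; rewrite ?powR_ge0 ?iota_uniq //.
by rewrite mem_index_iota /N ltnS (big_rem i) //= leq_maxl.
Qed.

(** Integers embed in pairs (sign, absolute value), which gives two copies of the series over the
    naturals. The shift by 1 keeps the base positive at 0. *)
Lemma abs_summable_int_power (a : R) : 1 < a ->
  abs_summable (fun m : int => `|m|%N.+1%:R `^ (- a) : R).
Proof.
move=> a1; pose h (m : int) := (m < 0, `|m|%N).
have hinj : injective h by move=> x y [] h1 h2; lia.
have hb : abs_summable (fun b : bool => 1 : R).
  exists (\sum_(i <- [:: true; false]) `|1|) => A uA.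
  by apply: ler_sum_subset => // -[].
have := abs_summable_comp hinj (abs_summable_prod hb (abs_summable_nat_power a1)).
by apply: abs_summable_le => m /=; rewrite mul1r.
Qed.

(** With z = a + b omega and N its norm, |ab| <= N, |a| + |b| <= a^2 + b^2 <= 2N and 1 <= N, whence
    the 4. The bound compares sums over Z[omega] with a product of two sums over Z. *)
Lemma eis_norm_bound z : z != 0 ->
  (`|eis_re z|.+1 * `|eis_om z|.+1 <= 4 * `|eis_norm z|)%N.
Proof.
move=> nz; have : 0 < eis_norm z by rewrite eis_norm_gt0.
rewrite /eis_norm; case: z {nz} => a b /=.
have sq (x : int) : `|x| <= x ^+ 2 by rewrite expr2; nia.
have h1 := sq a; have h2 := sq b.
have h3 := sqr_ge0 (a - b); have h4 := sqr_ge0 (a + b).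
rewrite !expr2 in h1 h2 h3 h4 *.
have h5 : `|a * b| <= (a * a - a * b + b * b).
  by rewrite ler_norml; apply/andP; split; lia.
rewrite normrM in h5 => h6; nia.
Qed.

Lemma abs_summable_complex (I : choiceType) (f : I -> R[i]) (g : I -> R) :
  (forall i, `|f i| <= (g i)%:C) -> abs_summable g -> abs_summable f.
Proof.
move=> fg [M hM]; exists M%:C => A uA.
apply: le_trans (_ : (\sum_(i <- A) `|g i|)%:C <= _); last by rewrite lecR hM.
rewrite sum_complex; apply: ler_sum => i _; apply: le_trans (fg i) _.
by rewrite lecR ler_norm.
Qed.

Lemma abs_summable_eis (s : R[i]) : 1 < complex.Re s ->
  abs_summable (fun z : eisenstein =>
    if z == 0 then 0 else cpow (eis_norm z)%:~R (- s)).
Proof.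
move=> s1; set a := complex.Re s in s1.
pose v (m : int) : R := `|m|%N.+1%:R `^ (- a).
have hv := abs_summable_int_power s1.
have pinj := can_inj eis_pairK.
have := abs_summableZ (4 `^ a) (abs_summable_comp pinj (abs_summable_prod hv hv)).
apply: abs_summable_complex => z /=.
case: eqP => [_|/eqP z0].
  by rewrite normr0 lecR !mulr_ge0 // powR_ge0.
have N0 : (0 < `|eis_norm z|)%N by have := eis_norm_gt0 z; rewrite z0; lia.
have NE : (eis_norm z)%:~R = `|eis_norm z|%N%:R :> R.
  by rewrite -[in LHS](gez0_abs (eis_norm_ge0 z)).
rewrite NE norm_cpow ?ltr0n // lecR -powRM ?ler0n //.
have -> : complex.Re (- s) = - a by rewrite /a; case: (s).
(* The constant moves inside the power, so that monotonicity in the base finishes. *)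
have -> : 4 `^ a = (4^-1) `^ (- a) :> R.
  by rewrite -powR_inv1 // -powRrM mulN1r opprK.
rewrite -powRM ?mulr_ge0 ?invr_ge0 ?ler0n //.
apply: powR_antimono; first by lra.
  by rewrite !mulr_gt0 ?invr_gt0 ?ltr0n.
rewrite mulrC ler_pdivrMr ?ltr0n // -!natrM ler_nat [leqRHS]mulnC.
exact: eis_norm_bound.
Qed.

End PowerSums.

(** * The zeta function: nonvanishing and sieving by primes *)

Section Zeta.
Variable R : realType.
Implicit Types t : R[i].

Lemma ReN (z : R[i]) : complex.Re (- z) = - complex.Re z.
Proof. by case: z. Qed.

Lemma abs_summable_zeta t : 1 < complex.Re t ->
  abs_summable (fun m : nat => cpow m.+1%:R (- t)).
Proof.
move=> t1; apply: abs_summable_complex (abs_summable_nat_power t1) => m.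
by rewrite norm_cpow ?ltr0n // ReN.
Qed.

Lemma zeta_has_sum t : 1 < complex.Re t ->
  has_sum (fun m : nat => cpow m.+1%:R (- t)) (zeta t).
Proof.
move=> t1; have [S hS] := abs_summable_has_sum (abs_summable_zeta t1).
by have -> : zeta t = S by exact: has_sum_series hS.
Qed.

(** Telescoping with 1/(x + 1)^2 <= 1/x - 1/(x + 1); the constant turns the base case into the
    equality 1/4 = 3/4 - 1/2. *)
Lemma inv_square_sum_bound N :
  \sum_(i < N.+1) (i.+2%:R ^- 2 : R) <= 3 / 4 - (N.+2%:R)^-1.
Proof.
elim: N => [|N IH]; first by rewrite big_ord1 -exprVn expr2 /=; lra.
rewrite big_ord_recr /=.
suff h : N.+3%:R ^- 2 <= N.+2%:R^-1 - N.+3%:R^-1 :> R.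
  by apply: le_trans (lerD IH h) _; rewrite addrA subrK.
have N0 : 0 < N.+2%:R :> R by rewrite ltr0n.
have -> : N.+3%:R = N.+2%:R + 1 :> R by rewrite natr1.
move: (N.+2%:R : R) N0 => x x0.
have -> : x^-1 - (x + 1)^-1 = (x * (x + 1))^-1.
  by field; apply/andP; split; apply: lt0r_neq0 => //; lra.
by rewrite lef_pV2 ?posrE ?exprn_gt0 ?mulr_gt0 //; try lra; nra.
Qed.

(* The tail of the series is at most 1/4 + sum_(m >= 3) 1/(m(m-1)) = 3/4. *)
Lemma zeta_neq0 t : 2 <= complex.Re t -> zeta t != 0.
Proof.
move=> t2; have t1 : 1 < complex.Re t by lra.
have hS := zeta_has_sum t1; apply/eqP => z0; rewrite z0 in hS.
(* Any positive tolerance below 1 - 3/4 would do. *)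
have e0 : (0 : R[i]) < (8^-1)%:C by rewrite ltcR invr_gt0 ltr0n.
have [A hA] := hS _ e0; pose N := \max_(i <- A) i.
set T := \sum_(i < N.+1) cpow i.+2%:R (- t).
have h : `|1 + T| < (8^-1)%:C.
  have := hA (index_iota 0 N.+2) (iota_uniq _ _).
  rewrite subr0 big_nat_recl // cpow1 big_mkord; apply => i iA.
  by rewrite mem_index_iota /N ltnS leqW // (big_rem i) //= leq_maxl.
have tail : `|T| <= (3 / 4)%:C.
  apply: le_trans (ler_norm_sum _ _ _) _.
  apply: le_trans (_ : (\sum_(i < N.+1) i.+2%:R ^- 2)%:C <= _); last first.
    rewrite lecR; apply: le_trans (inv_square_sum_bound N) _.
    by rewrite lerBlDr lerDl invr_ge0 ler0n.
  rewrite sum_complex; apply: ler_sum => i _; rewrite norm_cpow ?ltr0n // lecR.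
  by rewrite ReN -powR_mulrn ?ler0n // -powRN ler_powR ?ler1n //; lra.
have : (1 : R[i]) <= (8^-1)%:C + (3 / 4)%:C.
  apply: le_trans (lerD (ltW h) tail); rewrite -[X in X <= _]normr1.
  by apply: le_trans (ler_normB _ _); rewrite addrK.
by rewrite -rmorphD -[1]/(1%:C) lecR; lra.
Qed.

Lemma one_sub_cpow_neq0 (p : nat) t : (1 < p)%N -> 0 < complex.Re t ->
  1 - cpow p%:R (- t) != 0 :> R[i].
Proof.
move=> p1 t0; rewrite subr_eq0; apply/eqP => h.
have p0 : 0 < p%:R :> R by rewrite ltr0n ltnW.
have := norm_cpow (- t) p0; rewrite -h normr1 => /(congr1 (@complex.Re R)) /= h1.
have : p%:R `^ complex.Re (- t) < 1 :> R.
  by apply: powR_lt1; rewrite ?ltr1n // ReN oppr_lt0.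
by rewrite -h1 ltxx.
Qed.

(** Indexed by all naturals, with value 0 at 0, so that multiplication by p maps the index set into
    itself. *)
Definition sieved_power (ps : seq nat) t (m : nat) : R[i] :=
  if (0 < m)%N && all (fun p => ~~ (p %| m)%N) ps then cpow m%:R (- t) else 0.

(** Among the terms surviving [ps], those divisible by a new prime p are, after substituting pm for
    m, p^(-t) times the whole sieved series; removing them multiplies the sum by 1 - p^(-t). *)
Lemma zeta_sieve (ps : seq nat) t : 1 < complex.Re t -> uniq ps ->
  all prime ps ->
  has_sum (sieved_power ps t)
    (zeta t * \prod_(p <- ps) (1 - cpow p%:R (- t))).
Proof.
move=> t1; elim: ps => [_ _|p ps IH /= /andP[pps ups] /andP[pp prs]].
  rewrite big_nil mulr1; apply/(has_sum_reindex _ succn_inj).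
    by case=> [|m _]; [rewrite /sieved_power eqxx|exists m].
  by apply: has_sum_ext (zeta_has_sum t1) => m; rewrite /sieved_power.
have hS := IH ups prs; rewrite big_cons; set S := zeta t * _ in hS.
have inj : injective (muln p).
  by move=> x y /eqP; rewrite eqn_pmul2l ?prime_gt0 // => /eqP.
pose g m := if (p %| m)%N then sieved_power ps t m else 0.
have hg : has_sum g (cpow p%:R (- t) * S).
  apply/(has_sum_reindex _ inj).
    move=> m; rewrite /g; case: ifP => [/dvdnP[k ->] _|]; last by rewrite eqxx.
    by exists k; rewrite mulnC.
  apply: has_sum_ext (has_sumZ _ hS) => m /=.
  rewrite /g dvdn_mulr // /sieved_power muln_gt0 (prime_gt0 pp) /=.
  rewrite [in RHS](eq_in_all (a2 := fun q => ~~ (q %| m)%N)); last first.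
    move=> q qps /=; have qp := allP prs q qps.
    rewrite Euclid_dvdM // dvdn_prime2 // (negPf (_ : q != p)) //.
    by apply: contraNneq pps => <-.
  have [m0|m0] := posnP m; first by rewrite m0 /= mulr0.
  case: ifP => _; rewrite ?mulr0 //.
  by rewrite natrM cpowM // ltr0n // prime_gt0.
have := has_sumB hS hg.
rewrite (_ : S - _ = zeta t * ((1 - cpow p%:R (- t)) *
  \prod_(q <- ps) (1 - cpow q%:R (- t)))); last by rewrite /S; ring.
apply: has_sum_ext => m; rewrite /g /sieved_power /=.
by case: (p %| m)%N; rewrite ?andbF ?subrr ?subr0.
Qed.

End Zeta.

(** * Cosets and primitive elements congruent to 1 modulo 3 *)

Definition primary_primitive (z : eisenstein) : bool :=
  [&& coprimez (eis_re z) (eis_om z), (3 %| eis_om z)%Z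
    & (3 %| eis_re z - 1)%Z].

Lemma det2 (g : 'M[int]_2) : \det g = g 0 0 * g 1 1 - g 0 1 * g 1 0.
Proof.
rewrite (expand_det_row _ 0) !big_ord_recl big_ord0 /cofactor !det_mx11 !mxE.
have e1 : lift ord0 ord0 = 1 :> 'I_2 by apply: val_inj.
have e2 : lift 1 0 = 0 :> 'I_2 by apply: val_inj.
by rewrite !e1 ?e2 /= /bump /=; ring.
Qed.

Lemma in_Gamma3E (g : 'M[int]_2) : in_Gamma3 g =
  [&& g 0 0 * g 1 1 - g 0 1 * g 1 0 == 1, (3 %| (g 0 0 - 1)%R)%Z, (3 %| (g 0 1)%R)%Z,
      (3 %| (g 1 0)%R)%Z & (3 %| (g 1 1 - 1)%R)%Z].
Proof.
rewrite /in_Gamma3 det2; congr (_ && _).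
have E i j : (g i j == (1%:M : 'M[int]_2) i j %[mod 3])%Z =
    (3 %| (g i j - (i == j)%:R)%R)%Z by rewrite mxE eqz_mod_dvd.
apply/idP/idP.
  move=> /forallP h; have H i j := forallP (h i) j.
  have := H 0 0; have := H 0 1; have := H 1 0; have := H 1 1.
  by rewrite !E /= !subr0 => -> -> -> ->.
move=> /and4P[h1 h2 h3 h4].
have two (i : 'I_2) : i = 0 \/ i = 1.
  by case: i => -[|[|]] // ?; [left|right]; exact: val_inj.
apply/forallP => i; apply/forallP => j; rewrite E.
by case: (two i) (two j) => -> [] -> /=; rewrite ?subr0.
Qed.

Lemma Tmx_exp_mul m (g : 'M[int]_2) j :
  (Tmx ^+ m * g) 1 j = g 1 j /\ (Tmx ^+ m * g) 0 j = g 0 j + m%:Z * g 1 j.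
Proof.
elim: m => [|m [IH1 IH0]]; first by rewrite expr0 mul1r mul0r addr0.
have TE (h : 'M[int]_2) i : (Tmx * h) i j = (i == 0)%:R * h 0 j + h 1 j.
  rewrite !mxE !big_ord_recl big_ord0 !mxE addr0.
  have -> : lift ord0 ord0 = 1 :> 'I_2 by apply: val_inj.
  by case: i => -[|[|]] //= ?; rewrite ?mul0r ?mul1r.
rewrite exprS -mulrA !TE IH1 IH0 /= mul0r mul1r add0r; split=> //.
by rewrite intS; ring.
Qed.

Lemma matrix2P (g h : 'M[int]_2) : g 0 0 = h 0 0 -> g 0 1 = h 0 1 ->
  g 1 0 = h 1 0 -> g 1 1 = h 1 1 -> g = h.
Proof.
move=> h00 h01 h10 h11; apply/matrixP => i j.
have two (k : 'I_2) : k = 0 \/ k = 1.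
  by case: k => -[|[|]] // ?; [left|right]; exact: val_inj.
by case: (two i) (two j) => -> [] ->.
Qed.

(** Two top rows completing the same bottom row to determinant 1 differ by a multiple of that row,
    and the congruences modulo 3 make the multiple divisible by 3. *)
Lemma same_coset_row (g h : Gamma3) : same_coset g h <->
  val g 1 0 = val h 1 0 /\ val g 1 1 = val h 1 1.
Proof.
have shift (k : nat) (x y : Gamma3) : val y = (Tmx ^+ 3) ^+ k * val x ->
    val x 1 0 = val y 1 0 /\ val x 1 1 = val y 1 1.
  rewrite -exprM => ->.
  by have [-> _] := Tmx_exp_mul (3 * k) (val x) 0;
     have [-> _] := Tmx_exp_mul (3 * k) (val x) 1.
split.
  move=> /asboolP[[k|k] hk]; first exact: shift hk.
  have [|-> ->] // := shift k.+1 h g.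
  by rewrite hk NegzE -exprnN mulrA divrr ?mul1r // unitrX // Tmx3_unit.
move=> [e0 e1].
have := valP g; have := valP h; rewrite !in_Gamma3E.
move=> /and5P[/eqP dh /dvdzP[a' ha'] /dvdzP[b' hb'] _ _].
move=> /and5P[/eqP dg /dvdzP[a ha] /dvdzP[b hb] _ _].
(* If the top rows differ by [3 * t] times the bottom row, determinant 1 forces [t] to be this
   combination. *)
pose t := val g 0 0 * (b' - b) - val g 0 1 * (a' - a).
have key (x y : Gamma3) (t' : nat) :
    val y 0 0 = val x 0 0 + 3 * t'%:Z * val x 1 0 ->
    val y 0 1 = val x 0 1 + 3 * t'%:Z * val x 1 1 ->
    val x 1 0 = val y 1 0 -> val x 1 1 = val y 1 1 -> same_coset x y.
  move=> h0 h1 h2 h3; apply/asboolP; exists t'%:Z; rewrite -exprnP -exprM.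
  apply: matrix2P; rewrite ?h0 ?h1 -?h2 -?h3.
  - by have [_ ->] := Tmx_exp_mul (3 * t') (val x) 0; rewrite PoszM.
  - by have [_ ->] := Tmx_exp_mul (3 * t') (val x) 1; rewrite PoszM.
  - by have [-> _] := Tmx_exp_mul (3 * t') (val x) 0.
  - by have [-> _] := Tmx_exp_mul (3 * t') (val x) 1.
rewrite -e0 -e1 in dh.
have ea : val h 0 0 - val g 0 0 = 3 * (a' - a) by rewrite mulrBr; lia.
have eb : val h 0 1 - val g 0 1 = 3 * (b' - b) by rewrite mulrBr; lia.
have cross : (val h 0 0 - val g 0 0) * val g 1 1 =
    (val h 0 1 - val g 0 1) * val g 1 0.
  by rewrite !mulrBl; lia.
have h0 : val h 0 0 = val g 0 0 + 3 * t * val g 1 0.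
  rewrite -[LHS](subrK (val g 0 0)) addrC; congr (_ + _).
  have -> : 3 * t * val g 1 0 = val g 0 0 * (3 * (b' - b) * val g 1 0)
    - val g 0 1 * val g 1 0 * (3 * (a' - a)) by rewrite /t; ring.
  rewrite -ea -eb -cross -[LHS]mulr1 -dg; ring.
have h1 : val h 0 1 = val g 0 1 + 3 * t * val g 1 1.
  rewrite -[LHS](subrK (val g 0 1)) addrC; congr (_ + _).
  have -> : 3 * t * val g 1 1 = val g 0 0 * val g 1 1 * (3 * (b' - b))
    - val g 0 1 * (3 * (a' - a) * val g 1 1) by rewrite /t; ring.
  rewrite -ea -eb cross -[LHS]mulr1 -dg; ring.
(* [Tmx_exp_mul] treats natural exponents only; a negative [t] is handled by exchanging the two
   matrices. *)
clearbody t; have [[k tE]|[k tE]] : (exists k : nat, t = k%:Z) \/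
    (exists k : nat, t = - k%:Z).
  by case: t {h0 h1} => k; [left; exists k|right; exists k.+1; rewrite NegzE].
- by apply: (key _ _ k); rewrite -?tE.
- rewrite same_coset_sym; apply: (key _ _ k) => //.
  + by rewrite h0 tE -e0; ring.
  + by rewrite h1 tE -e1; ring.
Qed.

Definition coset_eis (q : Gamma3_cosets) : eisenstein :=
  Eisenstein (val (repr q : Gamma3) 1 1) (val (repr q : Gamma3) 1 0).

Lemma coset_eis_inj : injective coset_eis.
Proof.
move=> p q [h1 h0]; rewrite -(reprK p) -(reprK q).
by apply/eqmodP/same_coset_row.
Qed.

Lemma coset_eis_primary q : primary_primitive (coset_eis q).
Proof.
have := valP (repr q : Gamma3); rewrite in_Gamma3E.
move=> /and5P[/eqP d _ _ h2 h3]; rewrite /primary_primitive /= h2 h3 !andbT.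
apply/coprimezP; exists (val (repr q : Gamma3) 0 0, - val (repr q : Gamma3) 0 1).
by rewrite /= mulNr d.
Qed.

Lemma coset_eis_surj z : primary_primitive z -> exists q, coset_eis q = z.
Proof.
case: z => d c /and3P[/= /coprimezP[[u v] /= uv] c3 d1].
(* The Bezout relation ud + vc = 1 gives the top row (u, -v). Adding v times the bottom row makes
   its second entry divisible by 3 and its first entry 1 modulo 3. *)
pose g : 'M[int]_2 := \matrix_(i, j)
  (if i == 0 then if j == 0 then u + v * c else v * (d - 1)
   else if j == 0 then c else d).
have gG : in_Gamma3 g.
  rewrite in_Gamma3E !mxE /= c3 d1 !andbT dvdz_mull // andbT.
  apply/andP; split; first by apply/eqP; rewrite -[RHS]uv; ring.
  have -> : u + v * c - 1 = - u * (d - 1) by rewrite mulrBr mulNr mulr1; lia.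
  exact: dvdz_mull.
pose G : Gamma3 := exist _ g gG; pose q : Gamma3_cosets := (\pi G)%qT.
exists q; have /eqmodP/same_coset_row[] : (repr q = G %[mod Gamma3_cosets])%qT.
  by rewrite reprK.
by rewrite /coset_eis /= !mxE /= => -> ->.
Qed.

(** * The largest squarefree divisor and sums over divisors *)

Lemma max_squarefree_divisor_spec n : (0 < n)%N ->
  (max_squarefree_divisor n %| n)%N /\
  forall p, prime p -> (p %| n)%N -> (p %| max_squarefree_divisor n)%N.
Proof.
move=> n0; set m := max_squarefree_divisor n.
have le_m d : (d %| n)%N -> squarefree d -> (d <= m)%N.
  by move=> dn sd; apply: leq_bigmax_seq => //; rewrite -dvdn_divisors.
have m0 : (0 < m)%N by exact: le_m.
have [mn sm] : (m %| n)%N /\ squarefree m.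
  (* 0 is the value of the empty maximum, ruled out by [m0]. *)
  suff [m00|//] : m = 0%N \/ ((m %| n)%N /\ squarefree m) by rewrite m00 in m0.
  rewrite /m /max_squarefree_divisor big_seq_cond.
  apply: (big_ind (fun x => x = 0%N \/ ((x %| n)%N /\ squarefree x))) => [|x y hx hy|d].
  - by left.
  - by rewrite /maxn; case: ifP.
  - by rewrite -dvdn_divisors // => /andP[]; right.
split=> // p pp pn; apply/negPn/negP => pm.
have cop : coprime p m by rewrite prime_coprime.
(* A prime of [n] missing from [m] would yield the larger squarefree divisor [p * m]. *)
suff : (p * m <= m)%N.
  by have := prime_gt1 pp; nia.
apply: le_m; first by rewrite Gauss_dvd // pn.
rewrite /squarefree muln_gt0 prime_gt0 // m0 /=; apply/allP => q.
rewrite mem_primes => /and3P[qp _ _]; apply/negP.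
have [->|qnp] := eqVneq q p.
  by rewrite expnS expn1 dvdn_pmul2l ?prime_gt0 // (negPf pm).
rewrite Gauss_dvdr; last first.
  by rewrite coprimeXl // prime_coprime // dvdn_prime2.
have [_ /allP sq] := andP sm; have [qm|qm] := boolP (q \in primes m).
  by apply/negP/sq.
move=> q2; case/negP: qm; rewrite mem_primes qp m0 /=.
by apply: dvdn_trans q2; rewrite expnS dvdn_mulr.
Qed.

Lemma sum_divisors_multiple (m n : nat) : (0 < n)%N -> (m %| n)%N ->
  (\sum_(d <- divisors n | m %| d) d = m * sum_divisors (n %/ m))%N.
Proof.
move=> n0 mn; have m0 := dvdn_gt0 n0 mn.
have nm0 : (0 < n %/ m)%N by rewrite divn_gt0 // dvdn_leq.
rewrite /sum_divisors big_distrr /= -(big_map (muln m) xpredT id) /= -big_filter.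
apply: perm_big; apply: uniq_perm.
- exact/filter_uniq/divisors_uniq.
- rewrite map_inj_uniq ?divisors_uniq // => x y /eqP.
  by rewrite eqn_pmul2l // => /eqP.
move=> d; rewrite mem_filter -dvdn_divisors //; apply/andP/mapP.
  move=> [/dvdnP[e ->] en]; exists e; last by rewrite mulnC.
  by rewrite -dvdn_divisors // dvdn_divRL.
move=> [e]; rewrite -dvdn_divisors // dvdn_divRL // => en ->.
by rewrite dvdn_mulr // mulnC.
Qed.

(** A divisor of [n] that is a multiple of [n'] has the same primes as [n], so the product over
    primes leaves the sum. *)
Lemma sum_divisors_primes (R : realType) (n : nat) : (0 < n)%N ->
  let n' := max_squarefree_divisor n in
  \sum_(d <- divisors n | (n' %| d)%N)
     d%:R * n%:R * \prod_(p <- primes d) (1 - p%:R ^- 2) =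
  n%:R * (n'%:R * (sum_divisors (n %/ n'))%:R)
    * \prod_(p <- primes n) (1 - p%:R ^- 2) :> R.
Proof.
move=> n0 n'; have [n'n n'p] := max_squarefree_divisor_spec n0.
rewrite -natrM -sum_divisors_multiple // natr_sum mulr_sumr mulr_suml.
rewrite big_seq_cond [RHS]big_seq_cond; apply: eq_bigr => d /andP[].
rewrite -dvdn_divisors // => dn n'd; rewrite [n%:R * _]mulrC.
suff -> : primes d = primes n by [].
apply/eq_primes => p; rewrite !mem_primes n0 (dvdn_gt0 n0 dn) /=.
apply: andb_id2l => pp; apply/idP/idP => [pd|pn]; first exact: dvdn_trans dn.
exact: dvdn_trans (n'p p pp pn) n'd.
Qed.

(** With [U] and [V] the two rows read as Eisenstein integers, the image of omega is U/V = U
    conj(V)/N(V), and the omega-coordinate of U conj(V) is the determinant. *)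
Lemma Im_mobius_omega (R : realType) (g : 'M[int]_2) : \det g = 1 ->
  complex.Im (mobius g (omega R)) =
  Num.sqrt 3 / 2 / (eis_norm (Eisenstein (g 1 1) (g 1 0)))%:~R.
Proof.
move=> dg; set V := Eisenstein _ _; pose U := Eisenstein (g 0 1) (g 0 0).
have V0 : V != 0.
  apply/eqP => -[h1 h0]; move: dg.
  by rewrite det2 h1 h0 !mulr0 subrr => /eqP; rewrite eq_sym oner_eq0.
have -> : mobius g (omega R) = eis_val R U / eis_val R V.
  by rewrite /mobius /eis_val /= addrC [X in _ / X]addrC.
have vV : eis_val R V * eis_val R (eis_conj V) = ((eis_norm V)%:~R : R)%:C.
  by rewrite -eis_valM eis_mul_conj eis_intE /eis_val /= mul0r addr0 rmorph_int.
have N0 : (eis_norm V)%:~R != 0 :> R by rewrite intr_eq0 eis_norm_eq0.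
have -> : eis_val R U / eis_val R V =
    eis_val R (U * eis_conj V) * ((eis_norm V)%:~R^-1 : R)%:C.
  rewrite fmorphV /= -vV eis_valM invfM.
  have c0 : eis_val R (eis_conj V) != 0.
    by rewrite eis_val_eq0 -eis_norm_eq0 eis_norm_conj eis_norm_eq0.
  by field; rewrite c0 eis_val_eq0 V0.
rewrite eis_valE /= mulr0 add0r; congr (_ / _).
have -> : g 0 1 * - g 1 0 + g 0 0 * (g 1 1 - g 1 0) - g 0 0 * - g 1 0 = 1.
  by rewrite -[RHS]dg det2; ring.
by rewrite mul1r.
Qed.

(** * Elements = 1 (mod 3) as signed multiples of primitive ones *)

Definition primary_sign (m : nat) : int := if (m %% 3 == 1)%N then 1 else -1.

Definition primary_scale (p : nat * eisenstein) : eisenstein :=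
  (primary_sign p.1 * p.1%:Z)%:~R * p.2.

Lemma eis_scale (k : int) z : k%:~R * z = Eisenstein (k * eis_re z) (k * eis_om z).
Proof. by rewrite eis_intE; case: z => a b; congr Eisenstein => /=; ring. Qed.

Lemma primary_scaleE m w : let k := primary_sign m * m%:Z in
  primary_scale (m, w) = Eisenstein (k * eis_re w) (k * eis_om w).
Proof. exact: eis_scale. Qed.

Lemma absz_primary_sign m : `|(primary_sign m * m%:Z)%R|%N = m.
Proof. by rewrite abszM /primary_sign; case: ifP => _; rewrite mul1n. Qed.

Lemma primary_sign_mod3 m : coprime m 3 -> (3 %| (primary_sign m * m%:Z - 1)%R)%Z.
Proof.
rewrite coprime_sym prime_coprime // /primary_sign; case: ifP; lia.
Qed.

Definition primary_pair (p : nat * eisenstein) : bool :=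
  coprime p.1 3 && primary_primitive p.2.

(** The gcd of the coordinates recovers m; the nonzero integer factor then cancels. *)
Lemma primary_scale_inj p q : primary_pair p -> primary_pair q ->
  primary_scale p = primary_scale q -> p = q.
Proof.
have content u : primary_pair u -> gcdz (eis_re (primary_scale u))
    (eis_om (primary_scale u)) = u.1%:Z.
  case: u => m w; rewrite primary_scaleE /= => /andP[_ /and3P[cop _ _]].
  rewrite -mulz_gcdr absz_primary_sign.
  by rewrite (eqP cop) mulr1.
case: p q => [m w] [k v] hp hq e.
have := content _ hp; rewrite e content // => -[mk]; rewrite -mk in e hp *.
congr pair; apply: (eis_mulI _ e) => /eqP; rewrite eis_intE => /eqP[] /eqP.
rewrite mulf_eq0 /primary_sign; have /andP[/= + _] := hp.
by case: (k) => //= j; case: ifP.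
Qed.

Lemma primary_scale_mod3 p : primary_pair p -> rdvd 3%:R (primary_scale p - 1).
Proof.
case: p => m w; rewrite primary_scaleE => /andP[/= cm /and3P[_ w3 w1]].
apply/eis_rdvd_nat; rewrite /= oppr0 addr0 dvdz_mull // andbT.
set k := _ * m%:Z; have -> : k * eis_re w - 1 = k * (eis_re w - 1) + (k - 1) by ring.
by rewrite rpredD ?dvdz_mull ?primary_sign_mod3.
Qed.

(** The scale is the gcd of the coordinates, prime to 3 because the first coordinate is. Its signed
    version [k] is 1 modulo 3, so dividing by it preserves the class of 1. *)
Lemma primary_scale_surj z : rdvd 3%:R (z - 1) ->
  exists2 p, primary_pair p & primary_scale p = z.
Proof.
case: z => a b /eis_rdvd_nat /=; rewrite oppr0 addr0 => /andP[a1 b3].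
pose m := `|gcdz a b|%N; have mE : m%:Z = gcdz a b by rewrite gez0_abs.
have cm : coprime m 3.
  rewrite coprime_sym prime_coprime //; apply/negP => m3.
  have : (3 %| a)%Z by apply: (@dvdz_trans m%:Z); rewrite ?mE ?dvdz_gcdl.
  by lia.
have m0 : m%:Z != 0 by apply/eqP => -[m0]; rewrite m0 in cm.
have k3 := primary_sign_mod3 cm; set k := primary_sign m * m%:Z in k3.
have /dvdzP[a' aE] : (k %| a)%Z.
  by rewrite dvdzE absz_primary_sign -[m]/`|m%:Z|%N -dvdzE mE dvdz_gcdl.
have /dvdzP[b' bE] : (k %| b)%Z.
  by rewrite dvdzE absz_primary_sign -[m]/`|m%:Z|%N -dvdzE mE dvdz_gcdr.
exists (m, Eisenstein a' b'); last first.
  by rewrite primary_scaleE /= -/k aE bE ![k * _]mulrC.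
rewrite /primary_pair cm /=; apply/and3P; split => /=.
- have := mulz_gcdr k a' b'; rewrite absz_primary_sign ![k * _]mulrC -aE -bE -mE.
  rewrite -[RHS]mulr1 => /(mulfI m0) h.
  by rewrite /coprimez h.
- have -> : b' = b - b' * (k - 1) by rewrite bE; ring.
  by rewrite rpredB // dvdz_mull.
- have -> : a' - 1 = (a - 1) - a' * (k - 1) by rewrite aE; ring.
  by rewrite rpredB // dvdz_mull.
Qed.

(** * The evaluation of F at omega *)

(** Unlike multiplication by omega, this preserves the class of 1 modulo 3. It changes the norm, so
    only the index set is invariant, not the summand. *)
Definition eis_shear (z : eisenstein) : eisenstein :=
  Eisenstein (eis_re z + eis_om z) (eis_om z).
Definition eis_unshear (z : eisenstein) : eisenstein :=
  Eisenstein (eis_re z - eis_om z) (eis_om z).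

Lemma eis_shearK : cancel eis_shear eis_unshear.
Proof. by case=> a b; congr Eisenstein => /=; ring. Qed.

Lemma eis_unshearK : cancel eis_unshear eis_shear.
Proof. by case=> a b; congr Eisenstein => /=; ring. Qed.

Lemma primary_primitive_shear z :
  primary_primitive z -> primary_primitive (eis_shear z).
Proof.
case: z => a b /and3P[/= /coprimezP[[u v] /= h] b3 a1].
apply/and3P; split => //=; last by rewrite addrAC rpredD.
by apply/coprimezP; exists (u, v - u); rewrite /= -[RHS]h; ring.
Qed.

Lemma primary_primitive_unshear z :
  primary_primitive z -> primary_primitive (eis_unshear z).
Proof.
case: z => a b /and3P[/= /coprimezP[[u v] /= h] b3 a1].
apply/and3P; split => //=; last by rewrite addrAC rpredB.
by apply/coprimezP; exists (u, v + u); rewrite /= -[RHS]h; ring.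
Qed.

Lemma primary_primitive_conj z :
  primary_primitive z -> primary_primitive (eis_conj z).
Proof.
case: z => a b /and3P[/= /coprimezP[[u v] /= h] b3 a1].
apply/and3P; split => /=; last by rewrite addrAC rpredB.
  by apply/coprimezP; exists (u, - v - u); rewrite /= -[RHS]h; ring.
by rewrite rpredN.
Qed.

Section PrimarySums.
Variable R : realType.

(** Extension by 0 to all of Z[omega], so that conjugation and [eis_shear] act as bijections of the
    whole index type. *)
Definition primary_restr (f : eisenstein -> R[i]) (z : eisenstein) : R[i] :=
  if primary_primitive z then f z else 0.

Lemma primary_restr_perm (u v : eisenstein -> eisenstein) f S :
  cancel u v -> cancel v u ->
  (forall z, primary_primitive z -> primary_primitive (u z)) ->
  (forall z, primary_primitive z -> primary_primitive (v z)) ->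
  has_sum (primary_restr f) S -> has_sum (primary_restr (f \o u)) S.
Proof.
move=> uK vK pu pv hS.
have sur z : primary_restr f z != 0 -> exists y, u y = z by exists (v z).
apply: has_sum_ext (proj2 (has_sum_reindex _ (can_inj uK) sur) hS) => z.
rewrite /primary_restr /=; have -> // : primary_primitive (u z) = primary_primitive z.
by apply/idP/idP => [/pv|/pu //]; rewrite uK.
Qed.

Lemma primary_restr_lin f g a b S T :
  has_sum (primary_restr f) S -> has_sum (primary_restr g) T ->
  has_sum (primary_restr (fun z => a * f z + b * g z)) (a * S + b * T).
Proof.
move=> hS hT; apply: has_sum_ext (has_sumD (has_sumZ a hS) (has_sumZ b hT)) => z.
by rewrite /primary_restr; case: ifP; rewrite ?mulr0 ?addr0.
Qed.

Lemma primary_restr_bounded (s : R[i]) (b : eisenstein -> R[i]) (M : R[i]) :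
  1 < complex.Re s -> (forall z, `|b z| <= M) ->
  abs_summable (primary_restr (fun z => b z * cpow (eis_norm z)%:~R (- s))).
Proof.
move=> s1 bM.
apply: abs_summable_le (abs_summableZ M (abs_summable_eis s1)) => z.
rewrite /primary_restr; case: ifP => [pz|_]; last by rewrite normr0.
case: eqP => [z0|_]; first by rewrite z0 in pz.
rewrite !normrM ler_wpM2r // (le_trans (bM z)) // real_ler_norm //.
exact: ger0_real (le_trans (normr_ge0 _) (bM z)).
Qed.

End PrimarySums.

Section MainFormula.
Variables (R : realType) (n r : nat) (lam : 'I_r -> eisenstein) (c : 'I_r -> nat).
Variable s : R[i].
Hypotheses (n_gt0 : (0 < n)%N) (n3 : coprime n 3).
Hypothesis fac : prime_factorization n%:R lam c.
Hypothesis s1 : 1 < complex.Re s.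

Let chi := cubic_residue_prod lam c.
Let X z : R[i] := eis_val R (chi z).
Let Q z : R[i] := cpow (eis_norm z)%:~R (- s).
Let W : R := \sum_(d <- divisors n | (max_squarefree_divisor n %| d)%N)
  d%:R * n%:R * \prod_(p <- primes d) (1 - p%:R ^- 2).
Let A (N : int) : R := \sum_(d <- divisors n | coprime d `|gcdz n N|%N)
  d%:R ^+ 2 * (f_coef R n / (3 * f_coef R d)) * \prod_(p <- primes d) (1 - p%:R ^- 2).

Let C_coefE z : C_coef R n lam c (eis_re z) (- eis_om z) =
  A (eis_norm z) + 2 / 3 * complex.Re (X z) * W.
Proof.
rewrite /C_coef /A /X /W; congr (_ + _ * complex.Re (eis_val R _) * _).
  have -> : eis_re z ^+ 2 + eis_re z * - eis_om z + (- eis_om z) ^+ 2 = eis_norm z.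
    by rewrite /eis_norm; ring.
  by [].
congr (cubic_residue_prod lam c _); rewrite mulrNz mulNr opprK !eis_intE.
by case: z => a b; congr Eisenstein => /=; ring.
Qed.

Let XM x y : X (x * y) = X x * X y.
Proof. by rewrite /X /chi (cubic_residue_prodM n_gt0 n3 fac) eis_valM. Qed.

Let XN z : X (- z) = X z.
Proof. by rewrite /X /chi (cubic_residue_prodN n_gt0 n3 fac). Qed.

Let Xconj z : (X z)^* = X (eis_conj z).
Proof. by rewrite /X /chi (cubic_residue_prod_conj n_gt0 n3 fac) eis_val_conj. Qed.

Let norm_X z : `|X z| <= 1.
Proof.
rewrite /X /chi; case: (cubic_residue_prod_val n_gt0 n3 fac z) => [->|[k ->]].
  by rewrite eis_val0 normr0 ler01.
rewrite eis_valX normrX exprn_ile1 // eis_val_omega.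
rewrite -(@ler_pXn2r _ 2) ?nnegrE // -eis_val_omega norm_eis_val.
by rewrite expr1n.
Qed.

Let QM x y : x != 0 -> y != 0 -> Q (x * y) = Q x * Q y.
Proof.
move=> x0 y0; rewrite /Q eis_normM rmorphM /= cpowM //;
  by rewrite ltr0z eis_norm_gt0.
Qed.

Let primary_L_sum : abs_summable (primary_restr (fun z => X z * Q z)).
Proof. exact: primary_restr_bounded s1 norm_X. Qed.

(* The conjugate terms pair up: replacing a * X by its real part keeps only
   the real part of a in front of the sum. *)
Let Re_sum a P : has_sum (primary_restr (fun z => X z * Q z)) P ->
  has_sum (primary_restr (fun z => (complex.Re (a * X z))%:C * Q z))
    ((complex.Re a)%:C * P).
Proof.
move=> hP.
have hPc := primary_restr_perm eis_conjK eis_conjK primary_primitive_conj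
  primary_primitive_conj hP.
have := primary_restr_lin (a / 2) (a^* / 2) hP hPc.
have -> : a / 2 * P + a^* / 2 * P = (complex.Re a)%:C * P.
  by rewrite ReJ_add; field.
apply: has_sum_ext => z; rewrite /primary_restr; case: ifP => // _ /=.
rewrite -Xconj ReJ_add rmorphM /= {2}/Q eis_norm_conj -/(Q z); by field.
Qed.

(** The coprimality filter selects some of the divisors, so [A] is bounded independently of the
    norm. Convergence is what permits cancelling the two copies of this sum. *)
Let A_sum : exists U, has_sum (primary_restr (fun z => (A (eis_norm z))%:C * Q z)) U.
Proof.
pose M := \sum_(d <- divisors n) `|d%:R ^+ 2 * (f_coef R n / (3 * f_coef R d)) *
  \prod_(p <- primes d) (1 - p%:R ^- 2)| : R.
apply: abs_summable_has_sum; apply: (@primary_restr_bounded _ _ _ M%:C) => // z.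
rewrite normc_def /= expr0n addr0 sqrtr_sqr lecR.
apply: le_trans (ler_norm_sum _ _ _) _; rewrite big_mkcond.
by apply: ler_sum => d _; case: ifP.
Qed.

(** Stated for determinant 1 because it is also applied to [g * Smx], which lies outside
    Gamma(3). *)
Let F_summand (g : 'M[int]_2) : \det g = 1 ->
  (C_coef R n lam c (g 1 1) (- g 1 0))%:C
    * cpow (complex.Im (mobius g (omega R))) s =
  cpow (Num.sqrt 3 / 2) s *
  ((A (eis_norm (Eisenstein (g 1 1) (g 1 0))))%:C * Q (Eisenstein (g 1 1) (g 1 0))
   + (2 / 3 * W)%:C * ((complex.Re (X (Eisenstein (g 1 1) (g 1 0))))%:C
     * Q (Eisenstein (g 1 1) (g 1 0)))).
Proof.
move=> dg; rewrite Im_mobius_omega //; set z := Eisenstein _ _.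
have z0 : z != 0.
  apply/eqP => -[h1 h0]; move: dg.
  by rewrite det2 h1 h0 !mulr0 subrr => /eqP; rewrite eq_sym oner_eq0.
have N0 : 0 < (eis_norm z)%:~R :> R by rewrite ltr0z eis_norm_gt0.
rewrite cpowM ?invr_gt0 ?divr_gt0 ?sqrtr_gt0 ?ltr0n // cpow_inv // -/(Q z).
rewrite -[g 1 1]/(eis_re z) -[g 1 0]/(eis_om z) C_coefE.
by rewrite rmorphD !rmorphM /=; ring.
Qed.

Let F_sum P : has_sum (primary_restr (fun z => X z * Q z)) P ->
  complex.Re (X eis_omega) = - 2^-1 ->
  F_series n lam c (omega R) s =
    (2 * pi / (3 * n%:R))%:C * (cpow (Num.sqrt 3 / 2) s * (W%:C * P)).
Proof.
move=> hP hw; rewrite /F_series; congr (_ * _); apply: has_sum_csum.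
have [U hU] := A_sum.
have hR : has_sum (primary_restr (fun z => (complex.Re (X z))%:C * Q z)) P.
  have := Re_sum 1 hP; rewrite mul1r; apply: has_sum_ext => z.
  by rewrite /primary_restr mul1r.
have h1 := primary_restr_lin 1 (2 / 3 * W)%:C hU hR.
(* The second term is evaluated at omega times the sheared element, so chi(omega) enters as a
   factor, of which [Re_sum] keeps the real part. *)
have h2 := primary_restr_lin 1 (2 / 3 * W)%:C hU (Re_sum (X eis_omega) hP).
have {}h2 := primary_restr_perm eis_shearK eis_unshearK primary_primitive_shear
  primary_primitive_unshear h2.
have := has_sumZ (cpow (Num.sqrt 3 / 2) s) (has_sumB h1 h2).
(* The two copies of [U] cancel, and 2/3 (1 + 1/2) = 1. *)
rewrite hw (_ : _ - _ = W%:C * P); last first.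
  rewrite !rmorphM /= rmorphN /= !fmorphV /= !rmorph_nat; by field.
move=> hS; apply: has_sum_ext (proj2 (has_sum_reindex _ coset_eis_inj _) hS);
  last first.
  move=> z; rewrite /primary_restr; case: ifP => [/coset_eis_surj //|_].
  by rewrite subrr mulr0 eqxx.
move=> q.
rewrite /primary_restr /= coset_eis_primary mulrBr !mul1r.
set g := val (repr q : Gamma3); have dg : \det g = 1.
  by have /andP[/eqP] := valP (repr q : Gamma3).
congr (_ - _); first by rewrite F_summand.
have S00 : Smx 0 0 = 0 by rewrite mxE.
have S01 : Smx 0 1 = -1 by rewrite mxE.
have S10 : Smx 1 0 = 1 by rewrite mxE.
have S11 : Smx 1 1 = 0 by rewrite mxE.
have mulE i j : (g * Smx) i j = g i 0 * Smx 0 j + g i 1 * Smx 1 j.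
  rewrite mxE !big_ord_recl big_ord0 addr0.
  by have -> : lift ord0 ord0 = 1 :> 'I_2 by apply: val_inj.
have e0 : (g * Smx) 1 0 = g 1 1 by rewrite mulE S00 S10 mulr0 add0r mulr1.
have e1 : (g * Smx) 1 1 = - g 1 0 by rewrite mulE S01 S11 mulr0 addr0 mulrN1.
have dS : \det (g * Smx) = 1.
  by rewrite det_mulmx dg mul1r det2 S00 S01 S10 S11 mul0r mulr1 sub0r opprK.
have := F_summand dS; rewrite e0 e1.
(* Changing the sign of both arguments is harmless, since the norm and [X] are even. *)
have -> : C_coef R n lam c (- g 1 0) (- g 1 1) = C_coef R n lam c (g 1 0) (g 1 1).
  have := C_coefE (Eisenstein (- g 1 0) (g 1 1)).
  have := C_coefE (Eisenstein (g 1 0) (- g 1 1)); rewrite /= opprK => -> ->.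
  have -> : Eisenstein (- g 1 0) (g 1 1) = - Eisenstein (g 1 0) (- g 1 1).
    by congr Eisenstein; rewrite /= opprK.
  by rewrite XN eis_normN.
move=> ->; congr (_ * _).
have zE : Eisenstein (- g 1 0) (g 1 1) = eis_omega * eis_shear (coset_eis q).
  by rewrite /coset_eis -/g; congr Eisenstein => /=; ring.
have nE : eis_norm (Eisenstein (- g 1 0) (g 1 1)) = eis_norm (eis_shear (coset_eis q)).
  by rewrite zE eis_normM mul1r.
by rewrite /Q nE zE XM.
Qed.

(** 3 is sieved out as well because the scale m is prime to 3; it produces the factor 1 -
    3^(-2s). *)
Let ps := (3 :: primes n)%N.

Let ps_uniq : uniq ps.
Proof.
rewrite /= primes_uniq andbT mem_primes /= n_gt0 /=.
by move: n3; rewrite coprime_sym prime_coprime.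
Qed.

Let ps_prime : all prime ps.
Proof. by apply/andP; split => //; apply/allP => p; rewrite mem_primes => /andP[]. Qed.

Let Re2s : 2 < complex.Re (2 * s).
Proof. by rewrite mulr_natl mulr2n; move: s1; case: (s) => a b /=; lra. Qed.

Let sieve_coprime m : (0 < m)%N ->
  all (fun p => ~~ (p %| m)%N) ps = coprime m 3 && coprime m n.
Proof.
move=> m0; rewrite /= -prime_coprime // coprime_sym; congr (_ && _).
rewrite coprime_has_primes // -all_predC; apply: eq_in_all => p /=.
by rewrite !mem_primes m0 => /and3P[-> _ _].
Qed.

Let Q_nat m : (0 < m)%N -> Q (m%:R) = cpow m%:R (- (2 * s)).
Proof.
move=> m0; rewrite /Q eis_norm_nat rmorphXn /= -mulrN -cpow_sqr //.
by rewrite ltr0n.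
Qed.

Let L_term m w : (0 < m)%N -> primary_pair (m, w) ->
  X (primary_scale (m, w)) * Q (primary_scale (m, w)) =
  sieved_power ps (2 * s) m * primary_restr (fun z => X z * Q z) w.
Proof.
move=> m0 /andP[/= m3 pw]; rewrite /sieved_power m0 sieve_coprime // m3 /=.
rewrite /primary_restr pw.
have w0 : w != 0 by apply/eqP => w0; rewrite w0 in pw.
have mz : m%:R != 0 :> eisenstein.
  by rewrite -eis_norm_eq0 eis_norm_nat sqrf_eq0; case: (m) m0.
have scale : primary_scale (m, w) = m%:R * w \/ primary_scale (m, w) = - (m%:R * w).
  rewrite /primary_scale /primary_sign /=; case: ifP => _.
    by left; rewrite mul1r -pmulrn.
  by right; rewrite mulN1r mulrNz -pmulrn mulNr.
have XE : X (primary_scale (m, w)) = X m%:R * X w.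
  by case: scale => ->; rewrite ?XN XM.
have QE : Q (primary_scale (m, w)) = Q m%:R * Q w.
  case: scale => ->; first exact: QM.
  by rewrite -QM // /Q eis_normN.
rewrite XE QE Q_nat // /X /chi (cubic_residue_prod_nat n_gt0 n3 fac).
by case: coprime; rewrite ?eis_val1 ?eis_val0; ring.
Qed.

Let L_sum P : has_sum (primary_restr (fun z => X z * Q z)) P ->
  L_k (cubic_char n lam c) s =
    zeta (2 * s) * \prod_(p <- ps) (1 - cpow p%:R (- (2 * s))) * P.
Proof.
move=> hP; apply: has_sum_csum.
have t1 : 1 < complex.Re (2 * s) by move: Re2s; lra.
have hZ : has_sum (sieved_power ps (2 * s) \o succn)
    (zeta (2 * s) * \prod_(p <- ps) (1 - cpow p%:R (- (2 * s)))).
  apply: (proj2 (has_sum_reindex _ succn_inj _) (zeta_sieve t1 ps_uniq ps_prime)).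
  by case=> [|m _]; [rewrite /sieved_power eqxx|exists m].
have aZ : abs_summable (sieved_power ps (2 * s) \o succn).
  apply: abs_summable_le (abs_summable_zeta t1) => m /=.
  by rewrite /sieved_power; case: ifP; rewrite // normr0.
pose f2 (p : nat * eisenstein) := (sieved_power ps (2 * s) \o succn) p.1 *
  primary_restr (fun z => X z * Q z) p.2.
have [U hU] : exists U, has_sum f2 U.
  exact/abs_summable_has_sum/(abs_summable_prod aZ primary_L_sum).
rewrite -(has_sum_prod hZ hP hU).
(* [J] is a common index set: its image in the pairs contains the support of [f2], and
   [primary_scale] maps it bijectively onto the elements = 1 (mod 3). The shift by one enforces m >
   0. *)
pose J := {p : nat * eisenstein | primary_pair (p.1.+1, p.2)}.
have hJ : has_sum (f2 \o (val : J -> _)) U.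
  apply: (proj2 (has_sum_reindex _ val_inj _) hU) => -[m w].
  rewrite /f2 /= mulf_eq0 negb_or /sieved_power sieve_coprime // /primary_restr.
  case: ifP => [/andP[_ /andP[m3 _]]|]; last by rewrite eqxx.
  case: ifP => [pw _|]; last by rewrite eqxx andbF.
  have pj : primary_pair (m.+1, w) by rewrite /primary_pair /= m3.
  by exists (exist _ (m, w) pj).
have scale3 (j : J) : `[< rdvd 3%:R (primary_scale ((val j).1.+1, (val j).2) - 1) >].
  by apply/asboolP/primary_scale_mod3; exact: (valP j).
pose h (j : J) : {z : eisenstein | `[< rdvd 3%:R (z - 1) >]} :=
  exist (fun z : eisenstein => `[< rdvd 3%:R (z - 1) >]) _ (scale3 j).
have h_inj : injective h.
  move=> i j /(congr1 val) /= /(primary_scale_inj (valP i) (valP j)) e.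
  by apply: val_inj; case: (val i) (val j) e => [a b] [a' b'] /= [-> ->].
apply: (proj1 (has_sum_reindex _ h_inj _)).
  (* The scale 0 is excluded because [coprime 0 3] is false. *)
  move=> [z z3] _; have [[[|m] w] pj zE] := primary_scale_surj (asboolW z3).
    by [].
  by exists (exist _ (m, w) pj); apply: val_inj.
apply: has_sum_ext hJ => j.
have z3 := asboolW (scale3 j).
rewrite /f2 /= -L_term //; last exact: (valP j).
rewrite (cubic_char_prod n_gt0 n3 fac z3) cpow_norm_eis //.
by apply/eqP => z0; move: z3; rewrite z0 => /eis_rdvd_nat.
Qed.

Lemma F_series_omega :
  (n%:Z != 1 %[mod 9])%Z -> (n%:Z != -1 %[mod 9])%Z ->
  let n' := max_squarefree_divisor n in
  F_series n lam c (omega R) s =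
      (2 * pi * n'%:R * (sum_divisors (n %/ n'))%:R)%:C
        / (3 * (1 - cpow 3 (- (2 * s))))
      * cpow (Num.sqrt 3 / 2) s
      * (L_k (cubic_char n lam c) s / zeta (2 * s))
      * \prod_(p <- primes n)
          ((1 - p%:R ^- 2) / (1 - cpow p%:R (- (2 * s)))).
Proof.
move=> n1 n8 n'; have [P hP] := abs_summable_has_sum primary_L_sum.
rewrite (L_sum hP) (F_sum hP); last first.
  rewrite /X /chi; case: (cubic_residue_prod_omega n_gt0 n3 fac n1 n8) => ->;
  rewrite eis_valE /=; lra.
have t2 := Re2s; have z0 : zeta (2 * s) != 0 by apply: zeta_neq0; lra.
have e0 p : p \in ps -> 1 - cpow p%:R (- (2 * s)) != 0 :> R[i].
  by move=> /(allP ps_prime)/prime_gt1 p1; apply: one_sub_cpow_neq0 => //; lra.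
have e3 := e0 3%N (mem_head _ _).
rewrite /ps big_cons prodf_div; set E := \prod_(p <- primes n) (1 - cpow _ _).
have E0 : E != 0.
  rewrite prodf_seq_neq0; apply/allP => p pn /=; apply: e0.
  by rewrite in_cons pn orbT.
rewrite /W sum_divisors_primes // -/n' !rmorphM /= rmorph_prod /=.
under eq_bigr do rewrite rmorphB /= fmorphV rmorphXn /= rmorph_nat rmorph1.
have n0 : n%:R != 0 :> R[i] by rewrite pnatr_eq0 -lt0n.
rewrite fmorphV !rmorphM /= !rmorph_nat.
by field; rewrite E0 e3 z0 n0.
Qed.

End MainFormula.

Theorem theorem4p13 (R : realType) (n : nat)
    (r : nat) (lam : 'I_r -> eisenstein) (c : 'I_r -> nat) :
  (0 < n)%N ->
  coprime n 6 ->
  (n%:Z != 1 %[mod 9])%Z ->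
  (n%:Z != -1 %[mod 9])%Z ->
  (forall p : nat, prime p -> (p %| n)%N -> ~~ (3 %| logn p n)%N) ->
  prime_factorization n%:R lam c ->
  let n' := max_squarefree_divisor n in
  let chi := cubic_char n lam c in
  forall s : R[i], 1 < complex.Re s ->
    F_series n lam c (omega R) s =
      (2 * pi * n'%:R * (sum_divisors (n %/ n'))%:R)%:C
        / (3 * (1 - cpow 3 (- (2 * s))))
      * cpow (Num.sqrt 3 / 2) s
      * (L_k chi s / zeta (2 * s))
      * \prod_(p <- primes n)
          ((1 - p%:R ^- 2) / (1 - cpow p%:R (- (2 * s)))).
Proof.
move=> n_gt0 n6 n1 n8 _ fac n' chi s s1.
have n3 : coprime n 3 by apply: coprime_dvdr n6.
exact: (F_series_omega n_gt0 n3 fac s1 n1 n8).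
Qed.
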